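(* Consider the Retrospective Approximation (RA) iterates $\{X_k, k\ge 1\}$ with sample sizes $\{M_k\}$ and error tolerances $\{\epsilon_k\}$, as described in the context. Suppose that, as $k\to\infty$, $$M_k\to\infty \ \text{almost surely},\qquad \mathbb{E}[\epsilon_k\mid\mathcal{F}_{k-1}]\to0\ \text{almost surely}.$$ Suppose that the relative error class satisfies the uniform law $\sup_{x\in\mathbb{R}^d}\|R_m(x)\|\to0$ almost surely as $m\to\infty$, and that its envelope satisfies $\mathbb{E}[G^2(Y)]<\infty$. Suppose also that there is a constant $\ell_{2,\infty}<\infty$ with $$\sup_k\ \mathbb{E}\left[\|\nabla f(X_k)\|^2\mid\mathcal{F}_{k-1}\right]\le\ell_{2,\infty}^2<\infty .$$ Then, as $k\to\infty$, $$\mathbb{E}\left[\|\nabla f(X_k)\|\mid\mathcal{F}_{k-1}\right]\to0\ \text{almost surely},\qquad\text{and}\qquad \mathbb{E}\left[\|\nabla f(X_k)\|\right]\to0.$$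
   Context: Problem: minimize $f(x):=\mathbb{E}[F(x,Y)]$ over $x\in\mathbb{R}^d$, where $Y$ is a random variable with distribution $P$ on a measurable space $(\mathcal{Y},\mathcal{A})$, $F(\cdot,y)$ is a smooth function on $\mathbb{R}^d$ for every $y\in\mathcal{Y}$ with gradient $\nabla F(\cdot,y)$, and $\mathbb{E}[\nabla F(x,Y)]=\nabla f(x)$ for all $x$. $\|\cdot\|$ is the Euclidean norm. Sampling: $\{\tilde Y_j, j\ge1\}$ is an IID sequence of copies of $Y$. $M_1$ is a constant positive integer, $\mathcal{F}_0$ is trivial, $\mathcal{F}_k:=\sigma(\tilde Y_j: j\le \sum_{i=1}^k M_i)$, and the (positive-integer-valued) sample size $M_{k+1}$ is $\mathcal{F}_k$-measurable. At iteration $k$ the sample-path function and gradient are $$f_{M_k}(x):=\frac1{M_k}\sum_{j=1}^{M_k}F(x,Y_j),\qquad \nabla f_{M_k}(x):=\frac1{M_k}\sum_{j=1}^{M_k}\nabla F(x,Y_j),\qquad Y_j:=\tilde Y_{(\sum_{i=1}^{k-1}M_i)+j}.$$ RA algorithm: start from an initial guess $X_0$. At each outer iteration $k\ge1$, choose $M_k$ and a tolerance $\epsilon_k\ge0$, both $\mathcal{F}_{k-1}$-measurable; starting at $X_{k-1}$, run an iterative deterministic solver on the problem of minimizing $f_{M_k}$ over $\mathbb{R}^d$ until it produces a point $X_k$ with $\|\nabla f_{M_k}(X_k)\|\le\epsilon_k$. (It is assumed that the solver can always produce such a point.) Thus $X_k$ is $\mathcal{F}_k$-measurable. Relative error: fix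 $c_0>0$. $R(x,Y):=\frac{\nabla F(x,Y)-\nabla f(x)}{\|\nabla f(x)\|+c_0}$, the relative error class is $\{R(x,Y):x\in\mathbb{R}^d\}$, its envelope is $G(Y):=\sup_{x\in\mathbb{R}^d}\|R(x,Y)\|$. For $m\ge1$, $R_m(x):=\frac{\nabla f_m(x)-\nabla f(x)}{\|\nabla f(x)\|+c_0}$ with $\nabla f_m(x)=\frac1m\sum_{j=1}^m\nabla F(x,Y_j)$ and $Y_1,Y_2,\dots$ IID copies of $Y$. *)

(* Defs.v *)
From HB Require Import structures.
From mathcomp Require Import all_boot all_order all_algebra.
From mathcomp Require Import all_classical all_reals all_analysis.
From mathcomp Require Import measurable_realfun.

Set Implicit Arguments.
Unset Strict Implicit.
Unset Printing Implicit Defensive.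

Import Order.TTheory GRing.Theory Num.Theory.
Import numFieldNormedType.Exports.

Local Open Scope classical_set_scope.
Local Open Scope ring_scope.

(* The library norm on 'rV[R]_d is the sup norm; this is the Euclidean one. *)
Definition enorm {R : realType} {d : nat} (x : 'rV[R]_d) : R :=
  Num.sqrt (\sum_(i < d) x 0 i ^+ 2).

Definition grad {R : realType} {d : nat} (g : 'rV[R]_d -> R) (x : 'rV[R]_d) :
    'rV[R]_d :=
  \row_(i < d) 'D_(delta_mx 0 i) g x.

Section conditioning.
Context {dO : measure_display} {Omega : measurableType dO} {R : realType}.

Definition measurable_wrt {dU : measure_display} {U : sigmaRingType dU}
    (G : set (set Omega)) (X : Omega -> U) : Prop :=
  forall B : set U, measurable B -> G (X @^-1` B).

(* Z is a version of E[X | G], for a sub-sigma-algebra G and an X that is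
   nonnegative (possibly not integrable) or integrable.  Versions are a.s.
   unique, and a.s. nonnegative when X is. *)
Definition cond_expectation (P : probability Omega R) (G : set (set Omega))
    (X Z : Omega -> \bar R) : Prop :=
  measurable_wrt G Z /\
  forall A : set Omega, G A ->
    (\int[P]_(w in A) Z w = \int[P]_(w in A) X w)%E.

Record iid {dY : measure_display} {Y : measurableType dY}
    (P : probability Omega R) (PY : probability Y R) (Yt : nat -> Omega -> Y) :
    Prop := {
  iid_measurable : forall j, measurable_fun [set: Omega] (Yt j) ;
  iid_distribution : forall j (B : set Y), measurable B ->
    P (Yt j @^-1` B) = PY B ;
  iid_independent : forall (J : seq nat) (B : nat -> set Y), uniq J ->
    (forall j, measurable (B j)) ->
    P (\bigcap_(j in [set` J]) (Yt j @^-1` B j)) =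
      (\prod_(j <- J) P (Yt j @^-1` B j))%E }.

End conditioning.

Section problem.
Context {R : realType} {d : nat} {dY : measure_display} {Y : measurableType dY}.
Variables (PY : probability Y R) (F : 'rV[R]_d -> Y -> R).

Definition objective (x : 'rV[R]_d) : R := fine 'E_PY[F x]%E.

(* "Smooth" is read as continuously differentiable. *)
Record smooth_stochastic_problem : Prop := {
  F_differentiable : forall y x, differentiable (F^~ y) x ;
  F_grad_continuous : forall y, continuous (grad (F^~ y)) ;
  F_integrable : forall x, PY.-integrable [set: Y] (EFin \o F x) ;
  objective_differentiable : forall x, differentiable objective x ;
  gradF_integrable : forall x i,
    PY.-integrable [set: Y] (fun y => (grad (F^~ y) x 0 i)%:E) ;
  gradF_unbiased : forall x i,
    'E_PY[fun y => (grad (F^~ y) x 0 i)%R]%E = (grad objective x 0 i)%:E }.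

Definition sample_objective (m : nat) (ys : nat -> Y) (x : 'rV[R]_d) : R :=
  m%:R^-1 * \sum_(j < m) F x (ys j).

Definition sample_grad (m : nat) (ys : nat -> Y) (x : 'rV[R]_d) : 'rV[R]_d :=
  m%:R^-1 *: \sum_(j < m) grad (F^~ (ys j)) x.

Variable c0 : R.

Definition rel_error (x : 'rV[R]_d) (y : Y) : 'rV[R]_d :=
  (enorm (grad objective x) + c0)^-1 *: (grad (F^~ y) x - grad objective x).

Definition mean_rel_error (m : nat) (ys : nat -> Y) (x : 'rV[R]_d) : 'rV[R]_d :=
  (enorm (grad objective x) + c0)^-1 *:
    (sample_grad m ys x - grad objective x).

Definition envelope (y : Y) : \bar R :=
  ereal_sup (range (fun x : 'rV[R]_d => (enorm (rel_error x y))%:E)).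

End problem.

(* Indexing: M, eps and X carry their usual outer-iteration index (entry 0 of M
   and eps is never used), whereas Yt is 0-based: Yt j is the (j+1)-st element
   of the sequence, and likewise for each outer iteration's sample. *)
Section retrospective_approximation.
Context {R : realType} {d : nat} {dY : measure_display} {Y : measurableType dY}.
Context {dO : measure_display} {Omega : measurableType dO}.

Definition total_sample (M : nat -> Omega -> nat) (k : nat) (w : Omega) : nat :=
  (\sum_(i < k) M i.+1 w)%N.

(* sigma(Yt_j : j <= M_1 + ... + M_k) with a random number of generators: the
   sigma-algebra generated by the events { Yt_j is observed by the end of
   iteration k, and lies in B }.  B = setT makes the total sample size
   measurable, and for k = 0 this is the trivial sigma-algebra. *)
Definition history (Yt : nat -> Omega -> Y) (M : nat -> Omega -> nat) (k : nat) :
    set (set Omega) :=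
  <<s [set A | exists j (B : set Y), measurable B /\
         A = [set w | (j < total_sample M k w)%N /\ B (Yt j w)]] >>.

Definition fresh_sample (Yt : nat -> Omega -> Y) (M : nat -> Omega -> nat)
    (k : nat) (w : Omega) : nat -> Y :=
  fun j => Yt (total_sample M k.-1 w + j)%N w.

(* A deterministic iterative solver maps an objective g and a starting point x
   to its sequence of iterates. *)
Record RA_iterates (F : 'rV[R]_d -> Y -> R) (Yt : nat -> Omega -> Y)
    (solver : ('rV[R]_d -> R) -> 'rV[R]_d -> nat -> 'rV[R]_d)
    (M : nat -> Omega -> nat) (eps : nat -> Omega -> R)
    (X : nat -> Omega -> 'rV[R]_d) : Prop := {
  RA_solver_start : forall g x, solver g x 0%N = x ;
  (* for k = 0: M_1 is constant *)
  RA_size_measurable : forall k, measurable_wrt (history Yt M k) (M k.+1) ;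
  RA_size_gt0 : forall k w, (0 < M k.+1 w)%N ;
  RA_tol_measurable : forall k, measurable_wrt (history Yt M k) (eps k.+1) ;
  RA_tol_ge0 : forall k w, 0 <= eps k.+1 w ;
  (* for k = 0: the initial guess X_0 is deterministic *)
  RA_iterate_measurable : forall k i,
    measurable_wrt (history Yt M k) (fun w => X k w 0 i) ;
  RA_solve : forall k w, exists t,
    X k.+1 w = solver (sample_objective F (M k.+1 w) (fresh_sample Yt M k.+1 w))
                 (X k w) t ;
  RA_tolerance : forall k w,
    enorm (sample_grad F (M k.+1 w) (fresh_sample Yt M k.+1 w) (X k.+1 w))
      <= eps k.+1 w }.

End retrospective_approximation.

(* Main.v *)
Require Import Defs.
From HB Require Import structures.
From mathcomp Require Import all_boot all_order all_algebra.
From mathcomp Require Import all_classical all_reals all_analysis.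
From mathcomp Require Import measurable_realfun.
From mathcomp Require Import ring lra.

Set Implicit Arguments.
Unset Strict Implicit.
Unset Printing Implicit Defensive.

Import Order.TTheory GRing.Theory Num.Theory.
Import numFieldNormedType.Exports.

Local Open Scope classical_set_scope.
Local Open Scope ring_scope.

(** Write g for the norm of the gradient of the objective at the iterate produced
    by an outer iteration, S for the supremum over all points of the relative
    error of the batch used in that iteration, and eps for its tolerance.
    Splitting the gradient of the objective into the gradient of the sample
    objective and the sampling error gives g <= eps + S (g + c0). Although the
    iterate depends on the batch, S does not depend on the iterate: it is a
    statistic of the batch alone. Given the history, the batch is a fresh IID
    sample of a size m that is already known, so the conditional mean of S^2 is a
    number v(m) that depends on m only ([integral_fresh_sample_le]). By the
    conditional Cauchy-Schwarz inequality and the bound on the conditional second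
    moment of g, the conditional mean of S (g + c0) is at most a constant times
    the square root of v(m). Here this is Young's inequality with a weight close
    to the square root of v(m), which needs no conditional product inequality
    ([integral_grad_norm_fiber_le]).

    That v(m) tends to 0 ([mean_worst_error_cvg0]) is a uniform integrability
    statement. The squared supremum tends to 0 almost surely by the uniform law,
    and by convexity it is at most the average of the squared envelope over the
    batch. Truncating the envelope at a level L bounds it by L plus an average of
    identically distributed tails, whose mean does not depend on m and is small
    for large L; the truncated part is handled by dominated convergence.

    The first conclusion follows since the sample sizes tend to infinity. For the
    second one, the conditional bound need not be integrable, because nothing is
    assumed on the means of the tolerances; the bounded second moments allow
    truncating it at a constant before integrating
    ([integral_grad_norm_le_min]), and dominated convergence applies again.

    Two points of measure theory are needed on the way. Suprema over all points
    are measurable because the functions involved are continuous, so that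
    rational points suffice; the continuity of the gradient of the objective is
    not assumed but follows from the uniform law
    ([continuous_grad_objective]). And the history is a sigma-algebra at a random
    time; on the event that exactly n samples have been drawn it reduces to the
    sigma-algebra of the first n samples ([history_observed]), which is
    independent of the sequence from n on ([observed_sample_from]). *)

(** * The Euclidean norm, and countable reductions *)

Section euclidean_norm.
Context {R : realType} {d : nat}.
Implicit Types (x y : 'rV[R]_d).

Lemma enorm_ge0 x : 0 <= enorm x.
Proof. exact: sqrtr_ge0. Qed.

Lemma sqr_enorm x : enorm x ^+ 2 = \sum_(i < d) x 0 i ^+ 2.
Proof. by rewrite sqr_sqrtr// sumr_ge0// => i _; rewrite sqr_ge0. Qed.

Lemma enormN x : enorm (- x) = enorm x.
Proof.
by congr Num.sqrt; apply: eq_bigr => i _; rewrite mxE sqrrN.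
Qed.

Lemma enormZ (c : R) x : enorm (c *: x) = `|c| * enorm x.
Proof.
rewrite /enorm -sqrtr_sqr -sqrtrM ?sqr_ge0// mulr_sumr.
by congr Num.sqrt; apply: eq_bigr => i _; rewrite mxE exprMn.
Qed.

Lemma le_coord_enorm x i : `|x 0 i| <= enorm x.
Proof.
rewrite -sqrtr_sqr ler_sqrt; last by rewrite sumr_ge0// => j _; rewrite sqr_ge0.
by rewrite (bigD1 i)//= lerDl sumr_ge0// => j _; rewrite sqr_ge0.
Qed.

Lemma dot_le_enorm x y : \sum_(i < d) x 0 i * y 0 i <= enorm x * enorm y.
Proof.
have [x0|x0] := eqVneq (enorm x) 0.
  rewrite x0 mul0r big1// => i _.
  by have := le_coord_enorm x i; rewrite x0 normr_le0 => /eqP->; rewrite mul0r.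
have [y0|y0] := eqVneq (enorm y) 0.
  rewrite y0 mulr0 big1// => i _.
  by have := le_coord_enorm y i; rewrite y0 normr_le0 => /eqP->; rewrite mulr0.
have {}x0 : 0 < enorm x by rewrite lt_neqAle eq_sym x0 enorm_ge0.
have {}y0 : 0 < enorm y by rewrite lt_neqAle eq_sym y0 enorm_ge0.
(* Arithmetic-geometric inequality for the normalized coordinates: after
     summation, each of the two terms contributes half of the product. *)
set a := enorm y / enorm x / 2; set b := enorm x / enorm y / 2.
have le_i i : x 0 i * y 0 i <= a * x 0 i ^+ 2 + b * y 0 i ^+ 2.
  rewrite -subr_ge0.
  rewrite (_ : _ - _ = (enorm y * x 0 i - enorm x * y 0 i) ^+ 2
                       / (2 * enorm x * enorm y)); last first.
    by rewrite /a /b; field; rewrite !gt_eqF.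
  by rewrite divr_ge0 ?sqr_ge0// !mulr_ge0// ltW.
apply: (le_trans (ler_sum _ (fun i _ => le_i i))).
rewrite big_split/= -!mulr_sumr -!sqr_enorm le_eqVlt; apply/orP; left.
by apply/eqP; rewrite /a /b; field; rewrite !gt_eqF.
Qed.

Lemma ler_enormD x y : enorm (x + y) <= enorm x + enorm y.
Proof.
rewrite -(@ler_pXn2r _ 2)// ?nnegrE ?addr_ge0 ?enorm_ge0//.
rewrite sqr_enorm sqrrD !sqr_enorm.
rewrite (eq_bigr (fun i => x 0 i ^+ 2 + x 0 i * y 0 i *+ 2 + y 0 i ^+ 2)).
  rewrite 2!big_split/= lerD2r lerD2l sumrMnl.
  by rewrite lerMn2r dot_le_enorm.
by move=> i _; rewrite mxE sqrrD.
Qed.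

Lemma ler_enormB x y : enorm (x - y) <= enorm x + enorm y.
Proof. by rewrite (le_trans (ler_enormD _ _))// enormN. Qed.

Lemma continuous_enorm (T : topologicalType) (h : T -> 'rV[R]_d) (t : T) :
  (forall i, {for t, continuous (fun s => h s 0 i)}) ->
  {for t, continuous (fun s => enorm (h s))}.
Proof.
move=> ch; apply: (@continuous_comp _ _ _
  (fun s => \sum_(i < d) h s 0 i ^+ 2) Num.sqrt); last exact: sqrt_continuous.
apply: cvg_big => [|i _]; first exact: add_continuous.
apply: cvgM; exact: ch.
Qed.

Lemma sqr_enorm_mean_le m (u : 'I_m -> 'rV[R]_d) : (0 < m)%N ->
  enorm (m%:R^-1 *: \sum_(j < m) u j) ^+ 2 <=
  m%:R^-1 * \sum_(j < m) enorm (u j) ^+ 2.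
Proof.
move=> m0; have mR : 0 < m%:R :> R by rewrite ltr0n.
rewrite enormZ exprMn ger0_norm ?invr_ge0 ?ler0n// expr2 -mulrA.
rewrite ler_pM2l ?invr_gt0// mulrC ler_pdivrMr//.
rewrite sqr_enorm; under [X in _ <= X * _]eq_bigr do rewrite sqr_enorm.
rewrite exchange_big/= mulr_suml; apply: ler_sum => i _.
rewrite summxE.
(* Jensen's inequality for the square, as nonnegativity of the variance *)
set S := \sum_(j < m) u j 0 i.
have : 0 <= \sum_(j < m) (u j 0 i - S / m%:R) ^+ 2.
  by apply: sumr_ge0 => j _; rewrite sqr_ge0.
rewrite (eq_bigr (fun j => u j 0 i ^+ 2 - (S / m%:R * 2) * u j 0 i
    + (S / m%:R) ^+ 2)); last by move=> j _; ring.
rewrite big_split/= sumrB -mulr_sumr -/S sumr_const card_ord.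
rewrite -(mulr_natr (_ ^+ 2)).
move=> /(mulr_ge0 (ltW mR)); set Q := \sum_(j < m) _.
rewrite (_ : m%:R * _ = Q * m%:R - S ^+ 2) ?subr_ge0//.
by field; rewrite gt_eqF.
Qed.

End euclidean_norm.

Section rational_points.
Context {R : realType} {d : nat}.

Lemma ratr_row_near (x : 'rV[R]_d) (A : set 'rV[R]_d) : nbhs x A ->
  exists q : 'rV[rat]_d, A (map_mx ratr q).
Proof.
move=> /nbhs_ballP[e /= e0 xA].
have q_ i : {q : rat | ball (x 0 i) e (ratr q)}.
  apply/cid; have [||z [xz [q _ qz]]] := @dense_rat R (ball (x 0 i) e).
  - by exists (x 0 i); exact: ballxx.
  - exact: ball_open.
  - by exists q; rewrite qz.
exists (\row_i sval (q_ i)); apply: xA; split=> // i j.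
by rewrite !mxE ord1; case: (q_ j).
Qed.

Lemma le_continuous_ratr (h : 'rV[R]_d -> R) (c : \bar R) x :
  {for x, continuous h} ->
  (forall q : 'rV[rat]_d, ((h (map_mx ratr q))%:E <= c)%E) -> ((h x)%:E <= c)%E.
Proof.
move=> hx hc; rewrite leNgt; apply/negP => chx.
case: c hc chx => [c| |] hc chx //.
- rewrite lte_fin in chx.
  have [q /=] := ratr_row_near (hx _ (@lt_nbhsr _ _ _ chx)).
  by move: (hc q); rewrite lee_fin leNgt => /negP.
- by have := hc 0.
Qed.

(** Only a countable supremum of measurable functions is measurable in general;
    continuity makes the suprema over all points countable. *)
Lemma ereal_sup_ratr (h : 'rV[R]_d -> R) : continuous h ->
  ereal_sup (range (fun x => (h x)%:E)) =
  ereal_sup (range (fun q : 'rV[rat]_d => (h (map_mx ratr q))%:E)).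
Proof.
move=> ch; apply/eqP; rewrite eq_le; apply/andP; split.
- apply: ge_ereal_sup => _ [x _ <-].
  apply: le_continuous_ratr => [|q]; first exact: ch.
  by apply: ereal_sup_ubound; exists q.
- apply: ge_ereal_sup => _ [q _ <-]; apply: ereal_sup_ubound.
  by exists (map_mx ratr q).
Qed.

Lemma measurable_ereal_sup_countable (I : countType) (dT : measure_display)
    (T : measurableType dT) (f : I -> T -> \bar R) :
  (forall i, measurable_fun setT (f i)) ->
  measurable_fun setT (fun t => ereal_sup (range (f^~ t))).
Proof.
move=> mf.
apply: (measurability _ (ErealGenOInfty.measurableE R)) => _ [_ [r ->] <-].
rewrite (_ : _ `&` _ = \bigcup_i [set t | r%:E < f i t]%E).
  apply: countable_bigcupT_measurable => // i.
  by rewrite -[X in measurable X]setTI; exact: emeasurable_fun_o_infty.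
apply/seteqP; split=> [t [_ /=]|t [i _ /= rt]].
  rewrite in_itv/= andbT => /ereal_sup_gt[_ [i _ <-] ri].
  by exists i.
split=> //=; rewrite in_itv/= andbT (lt_le_trans rt)//.
by apply: ereal_sup_ubound; exists i.
Qed.

(** Random row vectors are only known to be measurable coordinate by coordinate.
    An open set of rows is a countable union of boxes with rational centres, and
    the event that a row lies in a box is one about its coordinates. *)
Lemma measurable_continuous_row (dT : measure_display) (T : measurableType dT)
    (h : 'rV[R]_d -> R) (X : T -> 'rV[R]_d) :
  continuous h -> (forall i, measurable_fun setT (fun t => X t 0 i)) ->
  measurable_fun setT (h \o X).
Proof.
move=> ch mX.
apply: (measurability _ (RGenOInfty.measurableE R)) => _ [_ [r ->] <-].
pose box (qn : 'rV[rat]_d * nat) : set 'rV[R]_d :=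
  [set x | forall i, `|x 0 i - ratr (qn.1 0 i)| < qn.2.+1%:R^-1].
rewrite (_ : _ `&` _ =
    \bigcup_qn [set t | box qn `<=` [set x | r < h x] /\ box qn (X t)]).
  apply: countable_bigcupT_measurable => // qn.
  have [sub|nsub] := pselect (box qn `<=` [set x | r < h x]); last first.
    by rewrite (_ : mkset _ = set0)//; apply/seteqP; split=> t // -[].
  rewrite (_ : mkset _ = \bigcap_(i in [set: 'I_d])
      [set t | `|X t 0 i - ratr (qn.1 0 i)| < qn.2.+1%:R^-1]); last first.
    by apply/seteqP; split=> [t [_ +] i _|t tX];
      [exact|split=> // i; exact: tX].
  apply: fin_bigcap_measurable => // i _.
  rewrite -[X in measurable X]setTI.
  have mi : measurable_fun setT (fun t => `|X t 0 i - ratr (qn.1 0 i)|).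
    by apply: measurableT_comp => //; exact: measurable_funB.
  have := mi measurableT `]-oo, qn.2.+1%:R^-1[%classic (measurable_itv _).
  by congr measurable; apply/seteqP; split=> t /=; rewrite in_itv.
apply/seteqP; split=> [t [_ /=]|t [qn _ /= [sub /sub]]]; last first.
  by rewrite in_itv/= andbT.
rewrite in_itv/= andbT => rt.
(* A box that contains X t stays in the ball of radius e around X t as soon as
   its half-width is below e / 2. *)
have /nbhs_ballP[e /= e0 sub] := ch (X t) _ (@lt_nbhsr _ _ _ rt).
have [n ne] : exists n : nat, n.+1%:R^-1 < e / 2.
  have e20 : 0 < e / 2 by rewrite divr_gt0.
  have [n _ /(_ n (leqnn n)) ?] := near_infty_natSinv_lt (PosNum e20).
  by exists n.
have n0 : 0 < n.+1%:R^-1 :> R by rewrite invr_gt0.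
have [q [_ Xq]] := ratr_row_near (nbhsx_ballx (X t) _ n0).
exists (q, n) => //; split=> /= [x xq|i]; last first.
  by have := Xq 0 i; rewrite /ball/= mxE.
apply: sub; split=> // i j; rewrite ord1 /ball/=.
have := Xq 0 j; rewrite /ball/= mxE => Xqj; have := xq j => /= xqj.
rewrite (_ : _ - _ =
  (X t 0 j - ratr (q 0 j)) - (x 0 j - ratr (q 0 j))); last by ring.
rewrite (le_lt_trans (ler_normB _ _))// (splitr e) ltrD// (lt_trans _ ne)//.
Qed.

End rational_points.

(** * Independence of the observed samples from the sequence that follows *)

Section restricted_integral.
Context {dT : measure_display} {T : measurableType dT} {R : realType}.
Variable mu : {measure set T -> \bar R}.

Lemma ge0_integral_mrestr (D : set T) (mD : measurable D) (f : T -> \bar R) :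
  measurable_fun setT f -> (forall t, (0 <= f t)%E) ->
  (\int[mrestr mu mD]_t f t = \int[mu]_(t in D) f t)%E.
Proof.
move=> mf f0; rewrite -(setUv D) ge0_integral_setU//.
- rewrite [X in (_ + X)%E](_ : _ = 0%E); last first.
    apply: null_set_integral => //; first exact: measurableC.
      exact: measurable_funTS.
    by rewrite /= /mrestr setICl measure0.
  rewrite adde0; apply: eq_measure_integral => A mA AD.
  by rewrite /= /mrestr setIidl.
- exact: measurableC.
- exact: measurable_funTS.
- exact/disj_setPCl.
Qed.

End restricted_integral.

Section samples.
Context {dY : measure_display} {Y : measurableType dY}.

(** The pi-system of finite-dimensional cylinders, which generates the product
    sigma-algebra on sequences. *)
Definition cylinders : set (set (nat -> Y)) :=
  [set E | exists m (B : nat -> set Y), (forall j, measurable (B j)) /\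
     E = [set ys | forall j, (j < m)%N -> B j (ys j)]].

Lemma cylindersI : setI_closed cylinders.
Proof.
move=> _ _ [m [B [mB ->]]] [m' [B' [mB' ->]]].
pose C m (B : nat -> set Y) j := if (j < m)%N then B j else setT.
exists (maxn m m'), (fun j => C m B j `&` C m' B' j); split.
  by move=> j; apply: measurableI; rewrite /C; case: ifP.
apply/seteqP; split=> [ys [h h'] j _|ys h].
  by split; rewrite /C; case: ifP => // jm; [exact: h|exact: h'].
split=> j jm; have := h j; rewrite leq_max jm ?orbT => /(_ isT)[];
  by rewrite /C jm.
Qed.

Lemma cylinders_setT : cylinders setT.
Proof.
by exists 0%N, (fun=> setT); split=> //; apply/seteqP; split.
Qed.

Definition sampleType := g_sigma_algebraType cylinders.

Lemma measurable_coord (j : nat) :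
  measurable_fun [set: sampleType] (fun ys : sampleType => (ys : nat -> Y) j).
Proof.
move=> _ B mB; rewrite setTI; apply: sub_sigma_algebra.
exists j.+1, (fun i => if i == j then B else setT); split=> [i|].
  by case: ifP.
apply/seteqP; split=> [ys By i|ys /(_ j (ltnSn j))]; last by rewrite eqxx.
by case: eqP => // ->.
Qed.

Context {dO : measure_display} {Omega : measurableType dO} {R : realType}.
Variables (P : probability Omega R) (PY : probability Y R).
Variable Yt : nat -> Omega -> Y.
Hypothesis iidY : iid P PY Yt.

Definition sample_from (n : nat) (w : Omega) : sampleType :=
  fun j => Yt (n + j)%N w.

Lemma measurable_sample_from n : measurable_fun setT (sample_from n).
Proof.
apply: (@measurability _ _ Omega sampleType _ _ cylinders erefl).
move=> _ [_ [m [B [mB ->]]] <-].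
rewrite (_ : _ `&` _ =
    \bigcap_(j in `I_m) (Yt (n + j)%N @^-1` B j)); last first.
  apply/seteqP; split=> [w [_ h] j jm|w h]; first exact: h.
  by split=> // j jm; exact: h.
apply: fin_bigcap_measurable => [|j _]; first exact: finite_II.
by rewrite -[X in measurable X]setTI; exact: (iid_measurable iidY).
Qed.

Definition observed_cylinders (n : nat) : set (set Omega) :=
  [set A | exists B : nat -> set Y, (forall j, measurable (B j)) /\
     A = [set w | forall j, (j < n)%N -> B j (Yt j w)]].

Definition observed (n : nat) : set (set Omega) := <<s observed_cylinders n >>.

Lemma observed_cylindersI n : setI_closed (observed_cylinders n).
Proof.
move=> _ _ [B [mB ->]] [B' [mB' ->]]; exists (fun j => B j `&` B' j).
split=> [j|]; first exact: measurableI.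
by apply/seteqP; split=> [w [h h'] j jn|w h]; split;
  [exact: h|exact: h'|move=> j /h[]..].
Qed.

Lemma observed_cylinders_measurable n : observed_cylinders n `<=` measurable.
Proof.
move=> _ [B [mB ->]].
rewrite (_ : mkset _ = \bigcap_(j in `I_n) (Yt j @^-1` B j)); last first.
  by apply/seteqP; split.
apply: fin_bigcap_measurable => [|j _]; first exact: finite_II.
by rewrite -[X in measurable X]setTI; exact: (iid_measurable iidY).
Qed.

Lemma observed_measurable n : observed n `<=` measurable.
Proof.
apply: smallest_sub; first exact: sigma_algebra_measurable.
exact: observed_cylinders_measurable.
Qed.

Lemma observed_setT n : observed_cylinders n setT.
Proof. by exists (fun=> setT); split=> //; apply/seteqP; split. Qed.

Lemma observed_preimage n j B : (j < n)%N -> measurable B ->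
  observed n (Yt j @^-1` B).
Proof.
move=> jn mB; apply: sub_sigma_algebra.
exists (fun i => if i == j then B else setT); split=> [i|].
  by case: ifP.
apply/seteqP; split=> [w Bw i _|w /(_ j jn)]; last by rewrite eqxx.
by case: eqP => // ->.
Qed.

Lemma observed_mono n n' : (n <= n')%N -> observed n `<=` observed n'.
Proof.
move=> nn'; apply: smallest_sub; first exact: smallest_sigma_algebra.
move=> _ [B [mB ->]]; apply: sub_sigma_algebra.
exists (fun j => if (j < n)%N then B j else setT); split=> [j|].
  by case: ifP.
apply/seteqP; split=> [w Bw j _|w h j jn].
  by case: ifP => // /Bw.
by have := h j (leq_trans jn nn'); rewrite jn.
Qed.

Lemma iid_cylinder (n : nat) (B : nat -> set Y) :
  (forall j, measurable (B j)) ->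
  P [set w | forall j, (j < n)%N -> B j (Yt j w)] =
  (\prod_(j <- iota 0 n) PY (B j))%E.
Proof.
move=> mB; rewrite (_ : mkset _ =
    \bigcap_(j in [set` iota 0 n]) (Yt j @^-1` B j)); last first.
  apply/seteqP; split=> w h j /=; first by rewrite mem_iota; exact: h.
  by move=> jn; apply: h => /=; rewrite mem_iota.
rewrite (iid_independent iidY) ?iota_uniq//.
by apply: eq_bigr => j _; exact: (iid_distribution iidY).
Qed.

Lemma iid_cylinder_sample_from (n m : nat) (B B' : nat -> set Y) :
  (forall j, measurable (B j)) -> (forall j, measurable (B' j)) ->
  P ([set w | forall j, (j < n)%N -> B j (Yt j w)] `&`
     sample_from n @^-1` [set ys | forall j, (j < m)%N -> B' j (ys j)]) =
  (P [set w | forall j, (j < n)%N -> B j (Yt j w)] *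
   P (sample_from 0 @^-1` [set ys | forall j, (j < m)%N -> B' j (ys j)]))%E.
Proof.
move=> mB mB'; pose C j := if (j < n)%N then B j else B' (j - n)%N.
rewrite (_ : _ `&` _ = [set w | forall j, (j < n + m)%N -> C j (Yt j w)]).
  rewrite !iid_cylinder//; last by move=> j; rewrite /C; case: ifP.
  rewrite iotaD big_cat/= add0n; congr (_ * _)%E.
    by apply: eq_big_seq => j; rewrite mem_iota add0n /C => /andP[_ ->].
  rewrite -[in LHS](addn0 n) iotaDl big_map; apply: eq_bigr => j _.
  by rewrite /C ltnNge leq_addr/= addKn.
apply/seteqP; split=> [w [h h'] j jnm|w h].
  rewrite /C; case: ltnP => nj; first exact: h.
  have := h' (j - n)%N; rewrite /sample_from/= subnKC//; apply.
  by rewrite ltn_subLR.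
split=> j jn.
  by have := h j (ltn_addr _ jn); rewrite /C jn.
have /= := h (n + j)%N; rewrite ltn_add2l => /(_ jn).
by rewrite /C ltnNge leq_addr/= addKn.
Qed.

(** Independence of the past and stationarity in one formula. On cylinders it is
    the product rule for finitely many samples; it extends to the sigma-algebras
    by uniqueness of finite measures on a pi-system, applied to the past with the
    cylinder of the future fixed, and then to the future. *)
Lemma observed_sample_from (n : nat) (A : set Omega) (E : set sampleType) :
  observed n A -> measurable E ->
  P (A `&` sample_from n @^-1` E) = (P A * P (sample_from 0 @^-1` E))%E.
Proof.
move=> oA mE; have mA : measurable A := observed_measurable oA.
have PA0 : 0 <= fine (P A) by exact: fine_ge0.
pose m1 : {measure set sampleType -> \bar R} :=
  pushforward (mrestr P mA) (sample_from n).
pose m2 : {measure set sampleType -> \bar R} := pushforward P (sample_from 0).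
pose m3 : {measure set sampleType -> \bar R} :=
  mscale (NngNum PA0) (m2 (measurable_sample_from 0)).
suff : m1 (measurable_sample_from n) E = m3 E.
  rewrite /m1 /m3 /m2 /= /mscale/= /pushforward /mrestr setIC => ->.
  by rewrite fineK// fin_num_measure.
have cover T : \bigcup_(k in [set: nat]) [set: T] = setT.
  by apply: bigcup_const; exists 0%N.
apply: (@measure_unique _ R sampleType cylinders (fun=> setT) erefl cylindersI
  (fun=> cylinders_setT) (cover _) (m1 (measurable_sample_from n)) m3) => //.
- move=> C cC; rewrite /m1 /m3 /m2 /= /mscale/= /pushforward /mrestr setIC.
  rewrite fineK ?fin_num_measure//.
  case: cC => m [B' [mB' ->]]; set C' := [set ys | _].
  have mC' k : measurable (sample_from k @^-1` C').
    rewrite -[X in measurable X]setTI; apply: measurable_sample_from => //.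
    by apply: sub_sigma_algebra; exists m, B'.
  have PC0 : 0 <= fine (P (sample_from 0 @^-1` C')) by exact: fine_ge0.
  transitivity (mscale (NngNum PC0) P A); last first.
    by rewrite /mscale/= fineK ?fin_num_measure// muleC.
  have -> : P (A `&` sample_from n @^-1` C') = mrestr P (mC' n) A by [].
  apply: (g_sigma_algebra_measure_unique (observed_cylinders n) _ (fun=> setT))
    => //.
  + exact: observed_cylinders_measurable.
  + by move=> _; exact: observed_setT.
  + exact: observed_cylindersI.
  + move=> _ [B [mB ->]]; rewrite /mrestr/= /mscale/=.
    rewrite fineK ?fin_num_measure// muleC -iid_cylinder_sample_from//.
  + move=> _; apply: (@le_lt_trans _ _ 1%E); last exact: ltry.
    by apply: probability_le1; exact: measurableI.
- move=> _; apply: (@le_lt_trans _ _ 1%E); last exact: ltry.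
  by apply: probability_le1; rewrite preimage_setT; exact: measurableI.
Qed.

Lemma integral_observed_sample_from (n : nat) (A : set Omega)
    (Q : sampleType -> \bar R) :
  observed n A -> measurable_fun setT Q -> (forall ys, (0 <= Q ys)%E) ->
  (\int[P]_(w in A) Q (sample_from n w) =
   P A * \int[P]_w Q (sample_from 0 w))%E.
Proof.
move=> oA mQ Q0; have mA : measurable A := observed_measurable oA.
have PA0 : 0 <= fine (P A) by exact: fine_ge0.
rewrite -(@ge0_integral_mrestr _ _ _ P A mA (Q \o sample_from n))//;
  last 2 first.
- by apply: measurableT_comp => //; exact: measurable_sample_from.
- by move=> w; exact: Q0.
have pushT k (mu : {measure set Omega -> \bar R}) :
    (\int[mu]_w Q (sample_from k w) =
     \int[pushforward mu (sample_from k)]_ys Q ys)%E.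
  rewrite (ge0_integral_pushforward (measurable_sample_from k) _ measurableT)//.
rewrite [LHS]pushT pushT.
rewrite -[P A]fineK ?fin_num_measure//.
rewrite -[X in (X * _)%E]/((NngNum PA0)%:num%:E) -ge0_integral_mscale//.
  exact: measurable_sample_from.
move=> m0; apply: (eq_measure_integral (mscale _ _)) => [|? E mE _ /=].
  exact: measurable_sample_from.
rewrite /mscale/= /pushforward /mrestr setIC observed_sample_from//.
by rewrite fineK// fin_num_measure.
Qed.

End samples.

(** * The history of the sampling *)

Section integral_partition.
Context {dT : measure_display} {T : measurableType dT} {R : realType}.
Variable mu : {measure set T -> \bar R}.

Lemma le_integral_fibers (N : T -> nat) (A : set T) (f g : T -> \bar R) :
  measurable A -> (forall n, measurable (N @^-1` [set n])) ->
  measurable_fun setT f -> measurable_fun setT g ->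
  (forall t, (0 <= f t)%E) -> (forall t, (0 <= g t)%E) ->
  (forall n, (\int[mu]_(t in A `&` N @^-1` [set n]) f t <=
              \int[mu]_(t in A `&` N @^-1` [set n]) g t)%E) ->
  (\int[mu]_(t in A) f t <= \int[mu]_(t in A) g t)%E.
Proof.
move=> mA mN mf mg f0 g0 fg.
have AE : A = \bigcup_n (A `&` N @^-1` [set n]).
  by apply/seteqP; split=> [t At|t [n _ []]//]; exists (N t).
have mAN n : measurable (A `&` N @^-1` [set n]) by exact: measurableI.
have tAN : trivIset setT (fun n => A `&` N @^-1` [set n]).
  apply/trivIsetP => i j _ _ /eqP ij; apply/seteqP; split=> // t.
  by move=> [[_ /= Ni] [_ /= Nj]]; apply: ij; rewrite -Ni -Nj.
rewrite AE !ge0_integral_bigcup//; try exact: measurable_funTS.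
by apply: lee_nneseries => [n _ _|n _]; [exact: integral_ge0|exact: fg].
Qed.

End integral_partition.

Section histories.
Context {dY : measure_display} {Y : measurableType dY}.
Context {dO : measure_display} {Omega : measurableType dO} {R : realType}.
Variables (P : probability Omega R) (PY : probability Y R).
Variables (Yt : nat -> Omega -> Y) (M : nat -> Omega -> nat).
Hypothesis iidY : iid P PY Yt.
Hypothesis measurable_M : forall k, measurable_wrt (history Yt M k) (M k.+1).

(** The events generating the history, named so that its sigma-algebra can be
    seen as that of a measurable type. *)
Definition history_events k : set (set Omega) :=
  [set A | exists j (B : set Y), measurable B /\
     A = [set w | (j < total_sample M k w)%N /\ B (Yt j w)]].

Local Notation ObsType n := (g_sigma_algebraType (observed_cylinders Yt n)).

Lemma history_observed_fibers k :
  (forall n, observed Yt n (total_sample M k @^-1` [set n])) ->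
  forall A n, history Yt M k A ->
    observed Yt n (A `&` total_sample M k @^-1` [set n]).
Proof.
move=> oN A n hA; move: A hA n.
apply: smallest_sub; first split.
- by move=> n; rewrite set0I; exact: (@measurable0 _ (ObsType n)).
- move=> A hA n; rewrite setTD.
  rewrite (_ : _ `&` _ = total_sample M k @^-1` [set n] `\`
                         (A `&` total_sample M k @^-1` [set n])).
    exact: (@measurableD _ (ObsType n) _ _ (oN n) (hA n)).
  apply/seteqP; split=> w [h h'] /=; first by split=> // -[/h].
  by split=> // Aw; apply: h'.
- move=> F hF n; rewrite setI_bigcupl.
  by apply: (@bigcupT_measurable _ (ObsType n)) => i; exact: hF.
move=> _ [j [B [mB ->]]] n.
case: (ltnP j n) => jn.
  rewrite (_ : _ `&` _ = Yt j @^-1` B `&` total_sample M k @^-1` [set n]).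
    apply: (@measurableI _ (ObsType n)); first exact: observed_preimage.
    exact: oN.
  by apply/seteqP; split=> w [] /=; [move=> [_ ? ->]|move=> ? ->].
rewrite (_ : _ `&` _ = set0); first exact: (@measurable0 _ (ObsType n)).
by apply/seteqP; split=> // w [[/= + _] /= wn]; rewrite wn ltnNge jn.
Qed.

Lemma total_sample_observed k n :
  observed Yt n (total_sample M k @^-1` [set n]).
Proof.
elim: k n => [|k IH] n.
  have [->|n0] := eqVneq n 0%N.
    rewrite (_ : _ @^-1` _ = setT); first exact: (@measurableT _ (ObsType 0)).
    by apply/seteqP; split=> w //= _; rewrite /total_sample big_ord0.
  rewrite (_ : _ @^-1` _ = set0); first exact: (@measurable0 _ (ObsType n)).
  apply/seteqP; split=> w //=; rewrite /total_sample big_ord0 => /esym/eqP.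
  by rewrite (negbTE n0).
rewrite (_ : _ @^-1` _ = \bigcup_(a in [set a | (a <= n)%N])
    (M k.+1 @^-1` [set (n - a)%N] `&` total_sample M k @^-1` [set a])).
  apply: (@bigcup_measurable _ (ObsType n)) => a /= an.
  apply: (observed_mono an); apply: history_observed_fibers => //.
  exact: measurable_M.
rewrite /total_sample; apply/seteqP; split=> w /=.
  rewrite big_ord_recr/= => <-; exists (\sum_(i < k) M i.+1 w)%N => /=.
    exact: leq_addr.
  by rewrite addKn.
by move=> [a /= an [Mw aw]]; rewrite big_ord_recr/= aw Mw subnKC.
Qed.

(** The history stops at a random index, but whether n samples have been drawn
    is decided by the first n of them, since every sample size is chosen from the
    samples drawn before. Hence a history event seen on that event involves a
    fixed number of samples, to which independence applies. *)
Lemma history_observed k n A : history Yt M k A ->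
  observed Yt n (A `&` total_sample M k @^-1` [set n]).
Proof.
move=> hA; apply: history_observed_fibers => // i.
exact: total_sample_observed.
Qed.

Lemma measurable_total_sample k n :
  measurable (total_sample M k @^-1` [set n]).
Proof.
apply: (observed_measurable iidY (n := n)); exact: total_sample_observed.
Qed.

Lemma history_measurable k : history Yt M k `<=` measurable.
Proof.
move=> A hA; rewrite (_ : A =
    \bigcup_n (A `&` total_sample M k @^-1` [set n])).
  apply: bigcupT_measurable => n.
  by apply: (observed_measurable iidY (n := n)); exact: history_observed.
by apply/seteqP; split=> [w Aw|w [n _ []]//]; exists (total_sample M k w).
Qed.

Lemma measurable_wrt_fun k dU (U : measurableType dU) (Z : Omega -> U) :
  measurable_wrt (history Yt M k) Z -> measurable_fun setT Z.
Proof.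
move=> mZ _ B mB; rewrite setTI.
by apply: (@history_measurable k); exact: mZ.
Qed.

Lemma historyI k A B : history Yt M k A -> history Yt M k B ->
  history Yt M k (A `&` B).
Proof.
exact: (@measurableI _ (g_sigma_algebraType (history_events k))).
Qed.

Lemma historyT k : history Yt M k setT.
Proof.
exact: (@measurableT _ (g_sigma_algebraType (history_events k))).
Qed.

Lemma measurable_fresh_sample k :
  measurable_fun setT (fun w => fresh_sample Yt M k.+1 w : sampleType).
Proof.
move=> _ E mE; rewrite setTI (_ : _ @^-1` _ =
    \bigcup_n (total_sample M k @^-1` [set n] `&` sample_from Yt n @^-1` E)).
  apply: bigcupT_measurable => n; apply: measurableI.
    exact: measurable_total_sample.
  rewrite -[X in measurable X]setTI; exact: (measurable_sample_from iidY).
by apply/seteqP; split=> [w Ew|w [n _ [/= <-]]//]; exists (total_sample M k w).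
Qed.

(** A statistic of the next batch is independent of the history and distributed
    as on the whole sequence: where n samples have been drawn, the next batch is
    the sequence from n on, and the sum over n recovers all of A. *)
Lemma integral_fresh_sample_le k A (Q : sampleType -> \bar R) :
  history Yt M k A -> measurable_fun setT Q -> (forall ys, (0 <= Q ys)%E) ->
  (\int[P]_(w in A) Q (fresh_sample Yt M k.+1 w) <=
   (\int[P]_w Q (sample_from Yt 0 w)) * P A)%E.
Proof.
move=> hA mQ Q0; have mA := @history_measurable k _ hA.
have v0 : (0 <= \int[P]_w Q (sample_from Yt 0 w))%E.
  by apply: integral_ge0 => w _.
rewrite -integral_cst//.
apply: (le_integral_fibers (N := total_sample M k)) => //.
- exact: measurable_total_sample.
- exact: (measurableT_comp mQ (measurable_fresh_sample k)).
- move=> n; rewrite integral_cst; last first.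
    by apply: measurableI => //; exact: measurable_total_sample.
  rewrite muleC -(integral_observed_sample_from (n := n) iidY)//; last first.
    exact: history_observed.
  by rewrite le_eqVlt; apply/orP; left; apply/eqP;
    apply: eq_integral => w; rewrite inE => -[_ /= <-].
Qed.

End histories.

(** * Relative errors *)

Section continuity.
Context {R : realType} {T : topologicalType}.

Lemma continuous_sqr (f : T -> R) :
  continuous f -> continuous (fun t => f t ^+ 2).
Proof. by move=> cf t; apply: cvgM; exact: cf. Qed.

Lemma continuous_mean m (h : 'I_m -> T -> R) :
  (forall j, continuous (h j)) ->
  continuous (fun t => m%:R^-1 * \sum_(j < m) h j t).
Proof.
move=> ch t; apply: cvgM; first exact: cvg_cst.
apply: cvg_big => [|j _]; first exact: add_continuous.
exact: ch.
Qed.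

Lemma continuous_enorm_scaled d (a : T -> R) (g h : T -> 'rV[R]_d) :
  (forall t, a t != 0) -> continuous a ->
  (forall i, continuous (fun t => g t 0 i)) ->
  (forall i, continuous (fun t => h t 0 i)) ->
  continuous (fun t => enorm ((a t)^-1 *: (g t - h t))).
Proof.
move=> a0 ca cg ch t.
apply: (continuous_enorm (h := fun s => (a s)^-1 *: (g s - h s))) => i.
rewrite (_ : (fun s => _) = fun s => (a s)^-1 * (g s 0 i - h s 0 i)).
  2: by apply/funext => s; rewrite !mxE.
apply: cvgM; first by apply: cvgV => //; exact: ca.
by apply: cvgB; [exact: cg|exact: ch].
Qed.

(** Convergence that is uniform relative to the size of the limit is locally
    uniform: an error of at most one half of the scale bounds the scale by a
    continuous function, hence by a constant near any point. *)
Lemma continuous_relative_limit d (c : R) (G : nat -> T -> 'rV[R]_d)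
    (g : T -> 'rV[R]_d) :
  0 < c -> (forall m i, continuous (fun t => G m t 0 i)) ->
  (forall r, 0 < r ->
     exists m, forall t, enorm (G m t - g t) <= r * (enorm (g t) + c)) ->
  forall i, continuous (fun t => g t 0 i).
Proof.
move=> c0 cG small i x0; apply/cvgrPdist_lt => e e0.
(* G m1 locally bounds the scale by K; G m2 then approximates g within a third
   of e wherever that bound holds. *)
have [m1 s1] := small (2^-1) ltac:(by rewrite invr_gt0).
pose K := 2 * (enorm (G m1 x0) + 1) + 2 * c.
have K0 : 0 < K.
  by rewrite addr_gt0 ?mulr_gt0// ltr_wpDl// enorm_ge0.
have leK x : enorm (G m1 x) <= enorm (G m1 x0) + 1 -> enorm (g x) + c <= K.
  move=> gx.
  have : enorm (g x) <= enorm (G m1 x) + 2^-1 * (enorm (g x) + c).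
    rewrite -[X in enorm X <= _](subKr (G m1 x)).
    by rewrite (le_trans (ler_enormB _ _))// lerD2l.
  by rewrite /K; lra.
have e3K : 0 < e / 3 / K by rewrite !divr_gt0.
have [m2 s2] := small _ e3K.
have close x : enorm (g x) + c <= K -> `|G m2 x 0 i - g x 0 i| <= e / 3.
  move=> xK; have := le_coord_enorm (G m2 x - g x) i.
  rewrite !mxE => /le_trans -> //; apply: (le_trans (s2 x)).
  rewrite -[leRHS](divfK (lt0r_neq0 K0)); apply: ler_wpM2l => //.
  exact: ltW.
have x0K := leK x0 ltac:(by rewrite lerDl).
have cn : {for x0, continuous (fun x => enorm (G m1 x))}.
  by apply: continuous_enorm => j; exact: cG.
have e30 : 0 < e / 3 by rewrite divr_gt0.
near=> x.
have xK : enorm (g x) + c <= K.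
  apply: leK; rewrite -lerBlDl; apply: le_trans (ler_norm _) _.
  rewrite distrC ltW//; near: x.
  by move/cvgrPdist_lt : cn; apply.
have xx0 : `|G m2 x0 0 i - G m2 x 0 i| < e / 3.
  by near: x; move/cvgrPdist_lt : (cG m2 i x0); apply.
have := close _ x0K; have := close _ xK; move: xx0.
rewrite !ltr_norml !ler_norml; lra.
Unshelve. all: by end_near. Qed.

End continuity.

Section relative_errors.
Context {R : realType} {d : nat} {dY : measure_display} {Y : measurableType dY}.
Variables (PY : probability Y R) (F : 'rV[R]_d -> Y -> R) (c0 : R).
Hypothesis smoothF : smooth_stochastic_problem PY F.
Hypothesis c0_gt0 : 0 < c0.

Local Notation gradf := (grad (objective PY F)).
Local Notation scale x := (enorm (gradf x) + c0).

Lemma scale_gt0 x : 0 < scale x.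
Proof. by rewrite ltr_wpDl// enorm_ge0. Qed.

Lemma enorm_sample_gradB m ys x :
  enorm (sample_grad F m ys x - gradf x) =
  enorm (mean_rel_error PY F c0 m ys x) * scale x.
Proof.
have sx := scale_gt0 x.
rewrite enormZ gtr0_norm ?invr_gt0// mulrAC mulVf ?mul1r// gt_eqF//.
Qed.

Lemma mean_rel_errorE m ys x : (0 < m)%N ->
  mean_rel_error PY F c0 m ys x =
  m%:R^-1 *: \sum_(j < m) rel_error PY F c0 x (ys j).
Proof.
move=> m0; rewrite /rel_error -scaler_sumr scalerA mulrC -scalerA.
congr (_ *: _).
rewrite sumrB sumr_const card_ord scalerBr; congr (_ - _).
by rewrite -scalerMnr scalerMnl -mulr_natr mulVf ?scale1r// pnatr_eq0 -lt0n.
Qed.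

Lemma continuous_sample_grad m ys i :
  continuous (fun x => sample_grad F m ys x 0 i).
Proof.
rewrite (_ : (fun x => _) =
    fun x => m%:R^-1 * \sum_(j < m) grad (F^~ (ys j)) x 0 i); last first.
  by apply/funext => x; rewrite mxE summxE.
apply: continuous_mean => j x.
apply: (@continuous_comp _ _ _ (grad (F^~ (ys j))) (fun u => u 0 i)).
  exact: (F_grad_continuous smoothF).
exact: coord_continuous.
Qed.

(** The objective is only known to be differentiable. Along a single sample
    sequence that satisfies the uniform law, its gradient is a locally uniform
    limit of the continuous gradients of the sample objectives. *)
Lemma continuous_grad_objective (ys : nat -> Y) :
  ereal_sup (range (fun x => (enorm (mean_rel_error PY F c0 m ys x))%:E))
    @[m --> \oo] --> 0%E ->
  forall i, continuous (fun x => gradf x 0 i).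
Proof.
move=> unif.
apply: (continuous_relative_limit (G := fun m => sample_grad F m ys) c0_gt0).
  by move=> m i; exact: continuous_sample_grad.
move=> t t0; have t0E : (0 < t%:E)%E by rewrite lte_fin.
have [m _ /(_ m (leqnn m))/= lt_t] := unif _ (open_ereal_lt' t0E).
exists m => x; rewrite enorm_sample_gradB ler_wpM2r ?(ltW (scale_gt0 _))//.
rewrite -lee_fin; apply/ltW/(le_lt_trans _ lt_t).
by apply: ereal_sup_ubound; exists x.
Qed.

Hypothesis continuous_gradf : forall i, continuous (fun x => gradf x 0 i).

Lemma continuous_enorm_gradf : continuous (fun x => enorm (gradf x)).
Proof. by move=> x; apply: continuous_enorm => i; exact: continuous_gradf. Qed.

Lemma continuous_relative (g : 'rV[R]_d -> 'rV[R]_d) :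
  (forall i, continuous (fun x => g x 0 i)) ->
  continuous (fun x => enorm ((scale x)^-1 *: (g x - gradf x))).
Proof.
move=> cg; apply: continuous_enorm_scaled => //.
- by move=> x; rewrite gt_eqF// scale_gt0.
- move=> x; apply: (@continuousD _ _ _ (fun x => enorm (gradf x)) (fun=> c0)).
    exact: continuous_enorm_gradf.
  exact: cst_continuous.
Qed.

Lemma continuous_mean_rel_error m ys :
  continuous (fun x => enorm (mean_rel_error PY F c0 m ys x)).
Proof. by apply: continuous_relative => i; exact: continuous_sample_grad. Qed.

Lemma continuous_rel_error y :
  continuous (fun x => enorm (rel_error PY F c0 x y)).
Proof.
apply: continuous_relative => i x.
apply: (@continuous_comp _ _ _ (grad (F^~ y)) (fun u => u 0 i)).
  exact: (F_grad_continuous smoothF).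
exact: coord_continuous.
Qed.

Definition worst_sqr_error (m : nat) (ys : sampleType (Y := Y)) : \bar R :=
  ereal_sup (range (fun x => (enorm (mean_rel_error PY F c0 m ys x) ^+ 2)%:E)).

Lemma worst_sqr_error_ub m ys x :
  ((enorm (mean_rel_error PY F c0 m ys x) ^+ 2)%:E <= worst_sqr_error m ys)%E.
Proof. by apply: ereal_sup_ubound; exists x. Qed.

Lemma worst_sqr_error_ge0 m ys : (0 <= worst_sqr_error m ys)%E.
Proof.
by apply: le_trans (worst_sqr_error_ub m ys 0); rewrite lee_fin sqr_ge0.
Qed.

Lemma measurable_enorm (dT : measure_display) (T : measurableType dT)
    (h : T -> 'rV[R]_d) : (forall i, measurable_fun setT (fun t => h t 0 i)) ->
  measurable_fun setT (fun t => enorm (h t)).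
Proof.
apply: (@measurable_continuous_row _ _ _ _ enorm) => x.
apply: (continuous_enorm (h := id)) => i; exact: coord_continuous.
Qed.

Lemma measurable_grad_coord x i :
  measurable_fun setT (fun y => grad (F^~ y) x 0 i).
Proof.
by apply/measurable_EFinP; have /integrableP[] := gradF_integrable smoothF x i.
Qed.

Lemma measurable_worst_sqr_error m : measurable_fun setT (worst_sqr_error m).
Proof.
have -> : worst_sqr_error m = fun ys => ereal_sup (range (fun q : 'rV[rat]_d =>
    (enorm (mean_rel_error PY F c0 m ys (map_mx ratr q)) ^+ 2)%:E)).
  apply/funext => ys; rewrite /worst_sqr_error.
  apply: (ereal_sup_ratr
    (h := fun x => enorm (mean_rel_error PY F c0 m ys x) ^+ 2)).
  exact/continuous_sqr/continuous_mean_rel_error.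
apply: measurable_ereal_sup_countable => q; apply/measurable_EFinP.
apply: measurable_funX; apply: measurable_enorm => i; set x := map_mx _ q.
rewrite (_ : (fun ys => _) = fun ys : sampleType => (scale x)^-1 *
    (m%:R^-1 * \sum_(j < m) grad (F^~ ((ys : nat -> Y) j)) x 0 i -
     gradf x 0 i)).
  2: by apply/funext => ys; rewrite !mxE summxE.
apply: measurable_funM => //; apply: measurable_funB => //.
apply: measurable_funM => //; apply: measurable_sum => j.
exact: (measurableT_comp (measurable_grad_coord _ _) (measurable_coord j)).
Qed.

Lemma envelope_ge0 y : (0 <= envelope PY F c0 y)%E.
Proof.
have -> : (0 = 0%:E)%E by [].
apply: (@le_trans _ _ (enorm (rel_error PY F c0 0 y))%:E).
  by rewrite lee_fin enorm_ge0.
by apply: ereal_sup_ubound; exists 0.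
Qed.

Lemma measurable_envelope : measurable_fun setT (envelope PY F c0).
Proof.
have -> : envelope PY F c0 = fun y => ereal_sup (range (fun q : 'rV[rat]_d =>
    (enorm (rel_error PY F c0 (map_mx ratr q) y))%:E)).
  apply/funext => y.
  apply: (ereal_sup_ratr (h := fun x => enorm (rel_error PY F c0 x y))).
  exact: continuous_rel_error.
apply: measurable_ereal_sup_countable => q; apply/measurable_EFinP.
apply: measurable_enorm => i; set x := map_mx _ q.
rewrite (_ : (fun y => _) =
    fun y => (scale x)^-1 * (grad (F^~ y) x 0 i - gradf x 0 i)).
  2: by apply/funext => y; rewrite !mxE.
apply: measurable_funM => //; apply: measurable_funB => //.
exact: measurable_grad_coord.
Qed.

Definition excess (L : R) (y : Y) : \bar R :=
  (maxe (envelope PY F c0 y ^+ 2 - L%:E) 0)%E.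

Lemma excess_ge0 L y : (0 <= excess L y)%E.
Proof. by rewrite /excess le_max lexx orbT. Qed.

Lemma measurable_excess L : measurable_fun setT (excess L).
Proof.
apply: measurable_maxe => //; apply: emeasurable_funB => //.
under eq_fun do rewrite expe2.
by apply: emeasurable_funM; exact: measurable_envelope.
Qed.

(** Convexity of the square bounds the error of the mean by an average over the
    sample, and truncation at L leaves an average of terms of small mean. *)
Lemma worst_sqr_error_le_excess (m : nat) (ys : nat -> Y) (L : R) : (0 < m)%N ->
  (worst_sqr_error m ys <=
   L%:E + (m%:R^-1)%:E * \sum_(j < m) excess L (ys j))%E.
Proof.
move=> m0; apply: ge_ereal_sup => _ [x _ <-].
have m0R : (0 : R) < m%:R by rewrite ltr0n.
have le_excess y :
    ((enorm (rel_error PY F c0 x y) ^+ 2 - L)%:E <= excess L y)%E.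
  rewrite /excess le_max; apply/orP; left.
  rewrite EFinB leeB// expe2 EFin_expe expe2.
  have le_env : ((enorm (rel_error PY F c0 x y))%:E <= envelope PY F c0 y)%E.
    by apply: ereal_sup_ubound; exists x.
  by apply: lee_pmul => //; rewrite lee_fin enorm_ge0.
rewrite mean_rel_errorE//.
apply: (@le_trans _ _ (L + m%:R^-1 * \sum_(j < m)
    (enorm (rel_error PY F c0 x (ys j)) ^+ 2 - L))%:E).
  rewrite lee_fin (le_trans (sqr_enorm_mean_le _ m0))//.
  rewrite sumrB sumr_const card_ord mulrBr -[L *+ m]mulr_natl mulrA.
  by rewrite mulVf ?gt_eqF// mul1r; lra.
rewrite EFinD leeD2l// EFinM lee_pmul2l ?lte_fin ?invr_gt0//.
by rewrite -sumEFin; apply: lee_sum => j _; exact: le_excess.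
Qed.

End relative_errors.

(** * Convergence to zero of the mean square of the worst relative error *)

Section ereal_limits.
Context {R : realType}.
Implicit Types u : nat -> \bar R.

Lemma cvge0_near_le u (e : R) : u n @[n --> \oo] --> 0%E -> 0 < e ->
  \forall n \near \oo, (u n <= e%:E)%E.
Proof.
move=> u0 e0; have e0E : (0 < e%:E)%E by rewrite lte_fin.
have lt_e : \forall n \near \oo, (u n < e%:E)%E := u0 _ (open_ereal_lt' e0E).
by apply: filterS lt_e => n /ltW.
Qed.

Lemma ge0_near_le_cvge0 u : (\forall n \near \oo, (0 <= u n)%E) ->
  (forall e : R, 0 < e -> \forall n \near \oo, (u n <= e%:E)%E) ->
  u n @[n --> \oo] --> 0%E.
Proof.
move=> u0 ue; have u_fin : \forall n \near \oo, u n \is a fin_num.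
  near=> n; rewrite ge0_fin_numE; last by near: n.
  by apply: (@le_lt_trans _ _ 1%:E); [near: n; exact: ue|exact: ltry].
apply/fine_cvgP; split => //; apply/cvgrPdist_le => e e0.
near=> n; have un0 : (0 <= u n)%E by near: n.
rewrite sub0r normrN/= ger0_norm ?fine_ge0// -lee_fin fineK; last by near: n.
by near: n; exact: ue.
Unshelve. all: by end_near. Qed.

End ereal_limits.

Section mean_worst_error.
Context {R : realType} {d : nat} {dY : measure_display} {Y : measurableType dY}.
Context {dO : measure_display} {Omega : measurableType dO}.
Variables (P : probability Omega R) (PY : probability Y R).
Variables (F : 'rV[R]_d -> Y -> R) (c0 : R) (Yt : nat -> Omega -> Y).
Hypothesis smoothF : smooth_stochastic_problem PY F.
Hypothesis c0_gt0 : 0 < c0.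
Hypothesis iidY : iid P PY Yt.
Hypothesis uniform_law : {ae P, forall w,
  ereal_sup (range (fun x : 'rV[R]_d =>
    (enorm (mean_rel_error PY F c0 m (Yt ^~ w) x))%:E)) @[m --> \oo] --> 0%E}.
Hypothesis envelope_L2 : (\int[PY]_y (envelope PY F c0 y ^+ 2) < +oo)%E.

Lemma continuous_coord_grad_objective i :
  continuous (fun x => grad (objective PY F) x 0 i).
Proof.
have PT : (0 < P [set: Omega])%E by rewrite probability_setT lte01.
have ae_proper := ae_properfilter_algebraOfSetsType PT.
have [w /= uw] := filter_ex uniform_law.
exact: (continuous_grad_objective smoothF c0_gt0 uw).
Qed.

Local Notation cgrad := continuous_coord_grad_objective.
Local Notation env2 := (fun y => (envelope PY F c0 y ^+ 2)%E).
Local Notation Q m := (worst_sqr_error PY F c0 m).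
Local Notation tail L := (excess PY F c0 L).

Lemma integral_sample (h : Y -> \bar R) j : measurable_fun setT h ->
  (forall y, (0 <= h y)%E) -> (\int[P]_w h (Yt j w) = \int[PY]_y h y)%E.
Proof.
move=> mh h0; have mYt := iid_measurable iidY j.
rewrite -[LHS](ge0_integral_pushforward mYt P measurableT mh); last first.
  by move=> y _; exact: h0.
apply: eq_measure_integral => //= B mB _.
exact: (iid_distribution iidY).
Qed.

Lemma measurable_env2 : measurable_fun setT env2.
Proof.
under eq_fun do rewrite expe2.
by apply: emeasurable_funM; apply: measurable_envelope => // i; exact: cgrad.
Qed.

Lemma env2_ge0 y : (0 <= env2 y)%E.
Proof.
rewrite -[leRHS]/(envelope PY F c0 y ^+ 2)%E expe2.
by rewrite mule_ge0// envelope_ge0.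
Qed.

Lemma integrable_env2 : PY.-integrable setT env2.
Proof.
apply/integrableP; split; first exact: measurable_env2.
by under eq_integral do rewrite gee0_abs ?env2_ge0//.
Qed.

Lemma excess_le_env2 (L : R) y : 0 <= L -> (tail L y <= env2 y)%E.
Proof.
move=> L0; rewrite ge_max env2_ge0 andbT.
by rewrite leeBlDr// leeDl// lee_fin.
Qed.

Lemma cvg_integral_excess :
  (\int[PY]_y tail n%:R y)%E @[n --> \oo] --> 0%E.
Proof.
have mtail n : measurable_fun setT (tail n%:R).
  by apply: measurable_excess => // i; exact: cgrad.
have [||_ _] := dominated_convergence (mu := PY) (f_ := fun n => tail n%:R)
  (f := cst 0%E) (g := env2) measurableT mtail (measurable_cst _)
  _ integrable_env2; last by rewrite integral0; apply.
- have := integrable_ae measurableT integrable_env2.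
  apply: filterS => y /(_ I) env_fin _; apply: cvg_near_cst.
  have [N _ leN] := nbhs_infty_ger (fine (env2 y)).
  exists N => //= n /leN; rewrite -lee_fin fineK// => le_n.
  by apply/max_idPr; rewrite leeBlDr// add0e.
- apply: filterE => y n _.
  by rewrite gee0_abs ?excess_ge0// excess_le_env2.
Qed.

Lemma measurable_worst_sqr_error_sample m :
  measurable_fun setT (fun w => Q m (sample_from Yt 0 w)).
Proof.
apply: measurableT_comp; last exact: (measurable_sample_from iidY).
by apply: measurable_worst_sqr_error => // i; exact: cgrad.
Qed.

(** The samples being identically distributed, the average of the tails has the
    mean of a single one: the last term is the same for all m, which replaces
    uniform integrability. *)
Lemma integral_worst_sqr_error_le m (L : R) : (0 < m)%N -> 0 <= L ->
  (\int[P]_w Q m (sample_from Yt 0 w) <=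
   \int[P]_w mine (Q m (sample_from Yt 0 w)) L%:E + \int[PY]_y tail L y)%E.
Proof.
move=> m0 L0; have m0R : (0 : R) < m%:R by rewrite ltr0n.
have mQ := measurable_worst_sqr_error_sample m.
have mtail : measurable_fun setT (tail L).
  by apply: measurable_excess => // i; exact: cgrad.
have mtailY j : measurable_fun setT (fun w => tail L (Yt j w)).
  by apply: measurableT_comp => //; exact: (iid_measurable iidY).
have msum : measurable_fun setT
    (fun w => (m%:R^-1)%:E * \sum_(j < m) tail L (Yt j w))%E.
  by apply: measurable_funeM; apply: emeasurable_sum => j; exact: mtailY.
have sum0 w : (0 <= (m%:R^-1)%:E * \sum_(j < m) tail L (Yt j w))%E.
  apply: mule_ge0; first by rewrite lee_fin invr_ge0.
  by apply: sume_ge0 => j _; exact: excess_ge0.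
have min0 w : (0 <= mine (Q m (sample_from Yt 0 w)) L%:E)%E.
  by rewrite le_min worst_sqr_error_ge0 lee_fin.
have mmin : measurable_fun setT (fun w => mine (Q m (sample_from Yt 0 w)) L%:E).
  exact: measurable_mine.
apply: (@le_trans _ _ (\int[P]_w (mine (Q m (sample_from Yt 0 w)) L%:E +
    (m%:R^-1)%:E * \sum_(j < m) tail L (Yt j w)))%E).
  apply: ge0_le_integral => //.
  - by move=> w _; exact: worst_sqr_error_ge0.
  - exact: emeasurable_funD.
  move=> w _; have [_|_] := leP (Q m (sample_from Yt 0 w)) L%:E.
    exact: leeDl.
  exact: worst_sqr_error_le_excess.
rewrite ge0_integralD// leeD2l// ge0_integralZl//; last 2 first.
- by apply: emeasurable_sum => j; exact: mtailY.
- by move=> w _; apply: sume_ge0 => j _; exact: excess_ge0.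
have mtailY' (j : 'I_m) := mtailY j.
have tailY0 (j : 'I_m) w : setT w -> (0 <= tail L (Yt j w))%E.
  by move=> _; exact: excess_ge0.
rewrite (ge0_integral_sum P measurableT mtailY' tailY0).
rewrite (eq_bigr (fun=> \int[PY]_y tail L y)%E); last first.
  by move=> j _; apply: integral_sample => // y; exact: excess_ge0.
have /fineK <- : (\int[PY]_y tail L y)%E \is a fin_num.
  rewrite ge0_fin_numE; last by apply: integral_ge0 => y _; exact: excess_ge0.
  apply: le_lt_trans envelope_L2; apply: ge0_le_integral => //.
  - by move=> y _; exact: excess_ge0.
  - exact: measurable_env2.
  - by move=> y _; exact: excess_le_env2.
rewrite sumEFin -EFinM lee_fin sumr_const card_ord -(mulr_natr (fine _)).
by rewrite mulrCA mulVf ?mulr1// gt_eqF.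
Qed.

Definition mean_worst_error m : \bar R :=
  (\int[P]_w Q m (sample_from Yt 0 w))%E.

Lemma mean_worst_error_ge0 m : (0 <= mean_worst_error m)%E.
Proof. by apply: integral_ge0 => w _; exact: worst_sqr_error_ge0. Qed.

Lemma mean_worst_error_lty m : (0 < m)%N -> (mean_worst_error m < +oo)%E.
Proof.
move=> m0; apply: le_lt_trans (integral_worst_sqr_error_le m0 (lexx 0)) _.
apply: lte_add_pinfty.
  rewrite (eq_integral (cst 0%E)) ?integral0 ?ltry// => w _.
  by rewrite (min_idPr _)// worst_sqr_error_ge0.
apply: le_lt_trans envelope_L2; apply: ge0_le_integral => //.
- by move=> y _; exact: excess_ge0.
- by apply: measurable_excess => // i; exact: cgrad.
- exact: measurable_env2.
- by move=> y _; exact: excess_le_env2.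
Qed.

Lemma ae_worst_sqr_error_cvg0 :
  {ae P, forall w, Q m (sample_from Yt 0 w) @[m --> \oo] --> 0%E}.
Proof.
apply: filterS uniform_law => w uw.
apply: ge0_near_le_cvge0 => [|e e0].
  by apply: nearW => m; exact: worst_sqr_error_ge0.
have t0 : 0 < Num.min e 1 by rewrite lt_min e0 ltr01.
have := cvge0_near_le uw t0; apply: filterS => m le_t.
apply: ge_ereal_sup => _ [x _ <-]; rewrite lee_fin.
have : enorm (mean_rel_error PY F c0 m (Yt^~ w) x) <= Num.min e 1.
  by rewrite -lee_fin; apply: le_trans le_t; apply: ereal_sup_ubound; exists x.
rewrite le_min => /andP[le_e le_1]; apply: le_trans le_e.
by rewrite expr2 ler_piMl// enorm_ge0.
Qed.

Lemma mean_worst_error_cvg0 : mean_worst_error m @[m --> \oo] --> 0%E.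
Proof.
apply: ge0_near_le_cvge0 => [|e e0].
  by apply: nearW => m; exact: mean_worst_error_ge0.
have e20 : 0 < e / 2 by rewrite divr_gt0.
have [N _ /(_ N (leqnn N))/= leN] := cvge0_near_le cvg_integral_excess e20.
have mmin m :
    measurable_fun setT (fun w => mine (Q m (sample_from Yt 0 w)) N%:R%:E).
  by apply: measurable_mine => //; exact: measurable_worst_sqr_error_sample.
have min0 m w : (0 <= mine (Q m (sample_from Yt 0 w)) N%:R%:E)%E.
  by rewrite le_min worst_sqr_error_ge0 lee_fin ler0n.
have cvg_min : (\int[P]_w mine (Q m (sample_from Yt 0 w)) N%:R%:E)%E
    @[m --> \oo] --> 0%E.
  have [||_ _] := dominated_convergence (mu := P)
    (f_ := fun m w => mine (Q m (sample_from Yt 0 w)) N%:R%:E)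
    (f := cst 0%E) (g := EFin \o cst N%:R) measurableT mmin (measurable_cst _)
    _ (finite_measure_integrable_cst P _ measurableT);
    last by rewrite integral0; apply.
  - apply: filterS ae_worst_sqr_error_cvg0 => w Q0 _.
    apply: ge0_near_le_cvge0 => [|r r0]; first exact: nearW.
    have := cvge0_near_le Q0 r0; apply: filterS => m Qr.
    by rewrite ge_min Qr.
  - apply: filterE => w m _; rewrite gee0_abs//.
    by rewrite ge_min lexx orbT.
near=> m; have m0 : (0 < m)%N by near: m; exact: nbhs_infty_gt.
apply: le_trans (integral_worst_sqr_error_le m0 (ler0n _ N)) _.
rewrite (splitr e) EFinD leeD//.
by near: m; exact: cvge0_near_le.
Unshelve. all: by end_near. Qed.

End mean_worst_error.

(** * Versions of conditional expectations *)

Section null_comparison.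
Context {dT : measure_display} {T : measurableType dT} {R : realType}.
Variable mu : {measure set T -> \bar R}.

Lemma integral_lt_null (D : set T) (f g : T -> \bar R) : measurable D ->
  measurable_fun D f -> measurable_fun D g ->
  (forall t, D t -> (0 <= f t)%E) -> (forall t, D t -> (f t < g t)%E) ->
  (\int[mu]_(t in D) g t <= \int[mu]_(t in D) f t)%E ->
  (\int[mu]_(t in D) f t < +oo)%E -> mu D = 0%E.
Proof.
move=> mD mf mg f0 fg gf f_fin.
have ffin t : D t -> f t \is a fin_num.
  by move=> Dt; rewrite ge0_fin_numE ?f0// (lt_le_trans (fg _ Dt))// leey.
have h0 t : D t -> (0 <= g t - f t)%E.
  by move=> Dt; rewrite sube_ge0 ?ffin// ltW// fg.
have mh : measurable_fun D (fun t => g t - f t)%E by exact: emeasurable_funB.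
have Df_fin : (\int[mu]_(t in D) f t)%E \is a fin_num.
  by rewrite ge0_fin_numE// integral_ge0.
have int0 : (\int[mu]_(t in D) (g t - f t) = 0)%E.
  apply/eqP; rewrite eq_le integral_ge0// andbT.
  rewrite -(leeD2lE _ _ Df_fin) adde0 -ge0_integralD//.
  rewrite (eq_integral g)// => t; rewrite inE => Dt.
  by rewrite addeC subeK// ffin.
have /ae_eq_integral_abs : (\int[mu]_(t in D) `|g t - f t|)%E = 0%E.
  rewrite -int0; apply: eq_integral => t; rewrite inE => Dt.
  by rewrite gee0_abs ?h0.
move=> /(_ mD mh) [N [mN N0 DN]].
apply/eqP; rewrite -measure_le0 -N0 le_measure ?inE// => t Dt; apply: DN => /=.
by move=> /(_ Dt) gft; have := fg _ Dt; rewrite -sube_gt0 gft ltxx.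
Qed.

End null_comparison.

Section conditional_expectations.
Context {dO : measure_display} {Omega : measurableType dO} {R : realType}.
Variables (P : probability Omega R) (H : set (set Omega)).
Hypothesis sub_measurable : <<s H>> `<=` measurable.
Local Notation SubType := (g_sigma_algebraType H).

Lemma measurable_wrtP dU (U : measurableType dU) (Z : Omega -> U) :
  measurable_wrt <<s H>> Z <-> measurable_fun [set: SubType] (Z : SubType -> U).
Proof.
split=> [mZ _ B mB|mZ B mB]; first by rewrite setTI; exact: mZ.
by have := mZ measurableT B mB; rewrite setTI.
Qed.

Lemma measurable_sub_fun dU (U : measurableType dU) (Z : Omega -> U) :
  measurable_fun [set: SubType] (Z : SubType -> U) -> measurable_fun setT Z.
Proof.
by move=> mZ _ B mB; apply: sub_measurable; exact: (mZ measurableT B mB).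
Qed.

Lemma cond_expectation_ge0 (X Z : Omega -> \bar R) :
  cond_expectation P <<s H>> X Z -> (forall w, (0 <= X w)%E) ->
  {ae P, forall w, (0 <= Z w)%E}.
Proof.
move=> [/measurable_wrtP mZ ZX] X0.
have mZO := measurable_sub_fun mZ.
pose A := [set w | (Z w < 0)%E].
have hA : <<s H>> A.
  have := measurable_lte (measurableT : measurable [set: SubType]) mZ
    (measurable_cst 0%E); by rewrite setTI.
have mA := sub_measurable hA.
exists A; split=> //; last by move=> w /= /negP; rewrite -ltNge.
apply: (@integral_lt_null _ _ _ P A (cst 0%E) (fun w => - Z w)%E) => //.
- by apply: measurableT_comp => //; exact: measurable_funTS.
- by move=> w /= Zw; rewrite oppe_gt0.
- rewrite integral0 -oppe_ge0 -integral_ge0N; last first.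
    by move=> w /= /ltW; rewrite oppe_ge0.
  by under eq_integral do rewrite oppeK; rewrite ZX// integral_ge0.
- by rewrite integral0.
Qed.

(** Versions are only almost surely nonnegative. Replacing one by its positive
    part makes the integral calculus of nonnegative functions available, with no
    integrability assumption on X. *)
Lemma integral_cond_expectation_pos (X Z : Omega -> \bar R) A :
  cond_expectation P <<s H>> X Z -> (forall w, (0 <= X w)%E) -> <<s H>> A ->
  (\int[P]_(w in A) maxe (Z w) 0 = \int[P]_(w in A) X w)%E.
Proof.
move=> cZ X0 hA; have [mZ ZX] := cZ; rewrite -ZX//.
have mZO : measurable_fun setT Z.
  by apply: measurable_sub_fun; exact/measurable_wrtP.
apply: ae_eq_integral; first exact: sub_measurable.
- by apply: measurable_funTS; exact: measurable_maxe.
- exact: measurable_funTS.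
- apply: filterS (cond_expectation_ge0 cZ X0) => w Z0 _.
  exact/max_idPl.
Qed.

Lemma cond_expectation_le (X Z B : Omega -> \bar R) :
  cond_expectation P <<s H>> X Z -> measurable_fun [set: SubType] B ->
  (forall w, (0 <= X w)%E) -> (forall w, (0 <= B w)%E) ->
  measurable_fun setT X -> (\int[P]_w X w < +oo)%E ->
  (forall A, <<s H>> A -> (\int[P]_(w in A) X w <= \int[P]_(w in A) B w)%E) ->
  {ae P, forall w, (Z w <= B w)%E}.
Proof.
move=> [/measurable_wrtP mZ ZX] mB X0 B0 mX X_fin XB.
pose A := [set w | (B w < Z w)%E].
have hA : <<s H>> A.
  have := measurable_lte (measurableT : measurable [set: SubType]) mB mZ.
  by rewrite setTI.
have mA := sub_measurable hA.
have mZA : measurable_fun A Z.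
  by apply: measurable_funTS; exact: measurable_sub_fun.
have mBA : measurable_fun A B.
  by apply: measurable_funTS; exact: measurable_sub_fun.
exists A; split=> //; last by move=> w /= /negP; rewrite -ltNge.
apply: (@integral_lt_null _ _ _ P A B Z) => //.
  by rewrite ZX//; exact: XB.
apply: (@le_lt_trans _ _ (\int[P]_(w in A) Z w)%E).
  by apply: ge0_le_integral => // w /= /ltW // BZ; exact: le_trans BZ.
rewrite ZX//; apply: le_lt_trans X_fin.
by apply: ge0_subset_integral.
Qed.

End conditional_expectations.

(** * Convergence of the gradients *)

(** Young's inequality with weight r. It lets first and second moments be bounded
    separately, where the Cauchy-Schwarz inequality would need a conditional
    version. *)
Lemma young_scale_le (R : realType) (g e s r c : R) : 0 < r ->
  g <= e + s * (g + c) -> g <= e + r * (g ^+ 2 + c ^+ 2) + s ^+ 2 / (2 * r).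
Proof.
move=> r0 ge; apply: (le_trans ge); rewrite -addrA lerD2l -subr_ge0.
rewrite (_ : _ - _ =
    ((s - r * (g + c)) ^+ 2 + r ^+ 2 * (g - c) ^+ 2) / (2 * r)); last first.
  by field; rewrite gt_eqF.
apply: divr_ge0; last by rewrite mulr_ge0// ltW.
by rewrite addr_ge0 ?sqr_ge0// -exprMn sqr_ge0.
Qed.

Section retrospective_approximation.
Context {R : realType} {d : nat} {dY : measure_display} {Y : measurableType dY}.
Context {dO : measure_display} {Omega : measurableType dO}.
Variables (P : probability Omega R) (PY : probability Y R).
Variables (F : 'rV[R]_d -> Y -> R) (c0 l2 : R) (Yt : nat -> Omega -> Y).
Variables (solver : ('rV[R]_d -> R) -> 'rV[R]_d -> nat -> 'rV[R]_d).
Variables (M : nat -> Omega -> nat) (eps : nat -> Omega -> R).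
Variables (X : nat -> Omega -> 'rV[R]_d) (Eeps Esq : nat -> Omega -> \bar R).
Hypothesis smoothF : smooth_stochastic_problem PY F.
Hypothesis c0_gt0 : 0 < c0.
Hypothesis iidY : iid P PY Yt.
Hypothesis RA : RA_iterates F Yt solver M eps X.
Hypothesis condEeps : forall k, cond_expectation P (history Yt M k)
  (fun w => (eps k.+1 w)%:E) (Eeps k).
Hypothesis condEsq : forall k, cond_expectation P (history Yt M k)
  (fun w => (enorm (grad (objective PY F) (X k.+1 w)) ^+ 2)%:E) (Esq k).
Hypothesis M_cvg : {ae P, forall w, M k w @[k --> \oo] --> \oo}.
Hypothesis Eeps_cvg : {ae P, forall w, Eeps k w @[k --> \oo] --> 0%E}.
Hypothesis uniform_law : {ae P, forall w,
  ereal_sup (range (fun x : 'rV[R]_d =>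
    (enorm (mean_rel_error PY F c0 m (Yt ^~ w) x))%:E)) @[m --> \oo] --> 0%E}.
Hypothesis envelope_L2 : (\int[PY]_y (envelope PY F c0 y ^+ 2) < +oo)%E.
Hypothesis Esq_bounded :
  {ae P, forall w, (ereal_sup (range (Esq ^~ w)) <= (l2 ^+ 2)%:E)%E}.

Local Notation G k := (fun w => enorm (grad (objective PY F) (X k.+1 w))).
Local Notation Q m := (worst_sqr_error PY F c0 m).
Local Notation v m := (mean_worst_error P PY F c0 Yt m).
Local Notation HistType k := (g_sigma_algebraType (history_events Yt M k)).

Let measurable_M : forall k, measurable_wrt (history Yt M k) (M k.+1) :=
  RA_size_measurable RA.

Let sub_measurable k : <<s history_events Yt M k>> `<=` measurable.
Proof. exact: (@history_measurable _ _ _ _ _ P PY Yt M iidY measurable_M k). Qed.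

Let cgrad i : continuous (fun x => grad (objective PY F) x 0 i).
Proof. exact: (continuous_coord_grad_objective smoothF c0_gt0 uniform_law). Qed.

Lemma measurable_grad_norm k : measurable_fun setT (G k).
Proof.
apply: (@measurable_continuous_row _ _ _ _
  (fun x => enorm (grad (objective PY F) x))).
  exact: continuous_enorm_gradf.
move=> i; apply: (measurable_wrt_fun iidY measurable_M).
exact: (RA_iterate_measurable RA).
Qed.

Lemma measurable_tolerance k : measurable_fun setT (eps k.+1).
Proof.
apply: (measurable_wrt_fun iidY measurable_M).
exact: (RA_tol_measurable RA).
Qed.

Lemma measurable_sqr_grad_norm k :
  measurable_fun setT (fun w => (G k w ^+ 2)%:E).
Proof.
by apply/measurable_EFinP; apply: measurable_funX; exact: measurable_grad_norm.
Qed.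

Lemma integral_sqr_grad_norm_le k A : history Yt M k A ->
  (\int[P]_(w in A) (G k w ^+ 2)%:E <= (l2 ^+ 2)%:E * P A)%E.
Proof.
move=> hA; have mA : measurable A by exact: (@sub_measurable k).
have G20 w : (0 <= (G k w ^+ 2)%:E)%E by rewrite lee_fin sqr_ge0.
rewrite -(integral_cond_expectation_pos (@sub_measurable k) (condEsq k) G20)//.
rewrite -integral_cst//; apply: ae_ge0_le_integral => //.
- by move=> w _; rewrite le_max lexx orbT.
- apply: measurable_funTS; apply: measurable_maxe => //.
  apply: (measurable_sub_fun (@sub_measurable k)).
  by apply/measurable_wrtP; exact: (condEsq k).1.
- by move=> w _; rewrite lee_fin sqr_ge0.
- apply: filterS Esq_bounded => w le_l2 _.
  rewrite ge_max lee_fin sqr_ge0 andbT; apply: le_trans le_l2.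
  by apply: ereal_sup_ubound; exists k.
Qed.

(** The weight of the order of the root mean square error makes both terms of
    Young's inequality small. The reciprocal keeps it positive when the mean
    square error vanishes. *)
Definition rms_weight (m : nat) : R := Num.sqrt (fine (v m)) + m.+1%:R^-1.

(** The mean of the right-hand side of Young's inequality, without the tolerance,
    when the second moment of the gradient norm is l2 squared. *)
Definition error_bound (m : nat) : R :=
  rms_weight m * (l2 ^+ 2 + c0 ^+ 2) + fine (v m) / (2 * rms_weight m).

Lemma rms_weight_gt0 m : 0 < rms_weight m.
Proof. by rewrite ltr_wpDl// ?sqrtr_ge0// invr_gt0. Qed.

Lemma error_bound_ge0 m : 0 <= error_bound m.
Proof.
have r0 := rms_weight_gt0 m.
rewrite addr_ge0//; first by rewrite mulr_ge0 ?addr_ge0 ?sqr_ge0// ltW.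
by rewrite divr_ge0 ?fine_ge0 ?mean_worst_error_ge0// mulr_ge0// ltW.
Qed.

Lemma error_bound_cvg0 : error_bound m @[m --> \oo] --> (0 : R).
Proof.
have v_cvg : fine (v m) @[m --> \oo] --> (0 : R).
  apply: fine_cvg.
  exact: (mean_worst_error_cvg0 smoothF c0_gt0 iidY uniform_law envelope_L2).
have sv_cvg : Num.sqrt (fine (v m)) @[m --> \oo] --> (0 : R).
  rewrite -(sqrtr0 R); apply: continuous_cvg => //; exact: sqrt_continuous.
have r_cvg : rms_weight m @[m --> \oo] --> (0 : R).
  rewrite -[0 in X in _ --> X]addr0; apply: cvgD => //; exact: cvg_harmonic.
have bound_cvg : rms_weight m * (l2 ^+ 2 + c0 ^+ 2) + Num.sqrt (fine (v m))
    @[m --> \oo] --> (0 : R).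
  rewrite -[0 in X in _ --> X](addr0 (0 : R)); apply: cvgD => //.
  rewrite -[0 in X in _ --> X](mul0r (l2 ^+ 2 + c0 ^+ 2)).
  by apply: cvgM => //; exact: cvg_cst.
apply: (squeeze_cvgr _ (cvg_cst 0) bound_cvg).
apply: nearW => m; rewrite error_bound_ge0/= lerD2l.
have r0 := rms_weight_gt0 m.
have v0 : 0 <= fine (v m) by rewrite fine_ge0// mean_worst_error_ge0.
rewrite ler_pdivrMr ?mulr_gt0//.
rewrite -{1}(sqr_sqrtr v0) expr2 ler_wpM2l ?sqrtr_ge0//.
rewrite mulrDr ler_wpDr//; last by rewrite ler_peMl ?sqrtr_ge0// ler1n.
Qed.

(** The relative error at the iterate is bounded by its supremum over all points,
    a quantity that no longer involves the iterate. *)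
Lemma grad_norm_le k m w (r : R) : M k.+1 w = m -> 0 < r ->
  ((G k w)%:E <= (eps k.+1 w)%:E + (r * (G k w ^+ 2 + c0 ^+ 2))%:E +
    (2 * r)^-1%:E * Q m (fresh_sample Yt M k.+1 w))%E.
Proof.
move=> Mm r0.
set s := enorm (mean_rel_error PY F c0 m (fresh_sample Yt M k.+1 w) (X k.+1 w)).
have Gle : G k w <= eps k.+1 w + s * (G k w + c0).
  rewrite -enorm_sample_gradB//; set sg := sample_grad _ _ _ _.
  rewrite -[X in enorm X <= _](subKr sg) (le_trans (ler_enormB _ _))// lerD2r.
  by have := RA_tolerance RA k w; rewrite Mm.
apply: (@le_trans _ _
  (eps k.+1 w + r * (G k w ^+ 2 + c0 ^+ 2) + s ^+ 2 / (2 * r))%:E).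
  by rewrite lee_fin; exact: young_scale_le.
rewrite !EFinD leeD2l// mulrC EFinM lee_pmul2l//; last first.
  by rewrite lte_fin invr_gt0 mulr_gt0.
exact: worst_sqr_error_ub.
Qed.

(** On an event of the history where the next sample size is m, the batch is a
    fresh sample of deterministic size, so that the mean of its squared worst
    error is v(m), unaffected by the dependence of the iterate on the batch. *)
Lemma integral_grad_norm_fiber_le k m A : (0 < m)%N -> history Yt M k A ->
  A `<=` M k.+1 @^-1` [set m] ->
  (\int[P]_(w in A) (G k w)%:E <=
   \int[P]_(w in A) (eps k.+1 w)%:E + (error_bound m)%:E * P A)%E.
Proof.
move=> m0 hA AM; have mA : measurable A by exact: (@sub_measurable k).
set r := rms_weight m; have r0 : 0 < r := rms_weight_gt0 m.
have r20 : 0 <= (2 * r)^-1 by rewrite invr_ge0 mulr_ge0// ltW.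
have mQ : measurable_fun setT (Q m).
  exact: measurable_worst_sqr_error.
have mQf : measurable_fun A (fun w => Q m (fresh_sample Yt M k.+1 w)).
  apply: measurable_funTS; apply: (measurableT_comp mQ).
  exact: (measurable_fresh_sample iidY measurable_M).
have mG2 : measurable_fun A (fun w => (r * (G k w ^+ 2 + c0 ^+ 2))%:E).
  apply/measurable_EFinP; apply: measurable_funM => //.
  apply: measurable_funD => //.
  apply: measurable_funX; apply: measurable_funTS; exact: measurable_grad_norm.
have meps : measurable_fun A (fun w => (eps k.+1 w)%:E).
  by apply/measurable_EFinP; apply: measurable_funTS; exact: measurable_tolerance.
have eps0 w : (0 <= (eps k.+1 w)%:E)%E.
  by rewrite lee_fin; exact: (RA_tol_ge0 RA).
have G20 w : (0 <= (r * (G k w ^+ 2 + c0 ^+ 2))%:E)%E.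
  by rewrite lee_fin mulr_ge0 ?addr_ge0 ?sqr_ge0// ltW.
have Q0 w : (0 <= (2 * r)^-1%:E * Q m (fresh_sample Yt M k.+1 w))%E.
  by rewrite mule_ge0 ?lee_fin// worst_sqr_error_ge0.
have mrQ : measurable_fun A
    (fun w => (2 * r)^-1%:E * Q m (fresh_sample Yt M k.+1 w))%E.
  exact: measurable_funeM.
apply: (@le_trans _ _ (\int[P]_(w in A) ((eps k.+1 w)%:E +
    (r * (G k w ^+ 2 + c0 ^+ 2))%:E +
    (2 * r)^-1%:E * Q m (fresh_sample Yt M k.+1 w)))%E).
  apply: ge0_le_integral => //.
  - by move=> w _; rewrite lee_fin enorm_ge0.
  - apply/measurable_EFinP; apply: measurable_funTS; exact: measurable_grad_norm.
  - by apply: emeasurable_funD => //; exact: emeasurable_funD.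
  - by move=> w Aw; apply: grad_norm_le => //; exact: AM.
rewrite ge0_integralD//; last 2 first.
- by move=> w _; exact: adde_ge0.
- exact: emeasurable_funD.
rewrite ge0_integralD// -addeA leeD2l//.
rewrite /error_bound EFinD ge0_muleDl ?lee_fin; last 2 first.
- by rewrite mulr_ge0 ?addr_ge0 ?sqr_ge0// ltW.
- by rewrite divr_ge0 ?fine_ge0 ?mean_worst_error_ge0// mulr_ge0// ltW.
apply: leeD.
  under eq_integral do rewrite EFinM.
  rewrite ge0_integralZl//; last 3 first.
  - apply/measurable_EFinP; apply: measurable_funD => //.
    apply: measurable_funX; apply: measurable_funTS; exact: measurable_grad_norm.
  - by move=> w _; rewrite lee_fin addr_ge0 ?sqr_ge0.
  - by rewrite lee_fin ltW.
  rewrite EFinM -muleA lee_pmul2l ?lte_fin//.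
  under eq_integral do rewrite EFinD.
  rewrite ge0_integralD//; last 3 first.
  - by move=> w _; rewrite lee_fin sqr_ge0.
  - by apply: measurable_funTS; exact: measurable_sqr_grad_norm.
  - by move=> w _; rewrite lee_fin sqr_ge0.
  rewrite integral_cst// EFinD ge0_muleDl ?lee_fin ?sqr_ge0//.
  by rewrite leeD2r//; exact: integral_sqr_grad_norm_le.
rewrite ge0_integralZl//; last by move=> w _; exact: worst_sqr_error_ge0.
rewrite (mulrC (fine _)) EFinM -muleA lee_pmul2l ?lte_fin ?invr_gt0 ?mulr_gt0//.
rewrite fineK; last first.
  rewrite ge0_fin_numE ?mean_worst_error_ge0//.
  exact: (mean_worst_error_lty smoothF c0_gt0 iidY uniform_law envelope_L2).
apply: (integral_fresh_sample_le iidY measurable_M) => // ys.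
exact: worst_sqr_error_ge0.
Qed.

Lemma integral_grad_norm_crude k A : history Yt M k A ->
  (\int[P]_(w in A) (G k w)%:E <= (1 + l2 ^+ 2)%:E * P A)%E.
Proof.
move=> hA; have mA : measurable A by exact: (@sub_measurable k).
have mG2 := measurable_funTS (D := A) (@measurable_sqr_grad_norm k).
apply: (@le_trans _ _ (\int[P]_(w in A) (1%:E + (G k w ^+ 2)%:E))%E).
  apply: ge0_le_integral => //.
  - by move=> w _; rewrite lee_fin enorm_ge0.
  - apply/measurable_EFinP; apply: measurable_funTS; exact: measurable_grad_norm.
  - exact: emeasurable_funD.
  - move=> w _; rewrite -EFinD lee_fin.
    by have := sqr_ge0 (G k w - 1); rewrite sqrrB1; have := enorm_ge0
      (grad (objective PY F) (X k.+1 w)); nra.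
rewrite ge0_integralD//; last first.
  by move=> w _; rewrite lee_fin sqr_ge0.
rewrite integral_cst// EFinD ge0_muleDl ?lee_fin ?sqr_ge0//.
by rewrite leeD2l//; exact: integral_sqr_grad_norm_le.
Qed.

(** An upper bound for every version of the conditional mean of the gradient
    norm. *)
Definition cond_bound k w : \bar R :=
  (maxe (Eeps k w) 0 + (error_bound (M k.+1 w))%:E)%E.

Lemma cond_bound_ge0 k w : (0 <= cond_bound k w)%E.
Proof. by rewrite adde_ge0 ?lee_fin ?error_bound_ge0// le_max lexx orbT. Qed.

Lemma measurable_pos_Eeps k :
  measurable_fun [set: HistType k] (fun w => maxe (Eeps k w) 0%E).
Proof.
by apply: measurable_maxe => //; apply/measurable_wrtP; exact: (condEeps k).1.
Qed.

Lemma measurable_error_bound k :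
  measurable_fun [set: HistType k] (fun w => (error_bound (M k.+1 w))%:E).
Proof.
apply/measurable_EFinP.
apply: (@measurableT_comp _ _ _ _ _ _ error_bound) => //.
by apply/measurable_wrtP; exact: measurable_M.
Qed.

Lemma measurable_cond_bound k : measurable_fun [set: HistType k] (cond_bound k).
Proof.
exact: emeasurable_funD (@measurable_pos_Eeps k) (@measurable_error_bound k).
Qed.

Lemma integral_grad_norm_le k A : history Yt M k A ->
  (\int[P]_(w in A) (G k w)%:E <= \int[P]_(w in A) cond_bound k w)%E.
Proof.
move=> hA; have mA : measurable A by exact: (@sub_measurable k).
have hM m : history Yt M k (M k.+1 @^-1` [set m]) by exact: measurable_M.
apply: (le_integral_fibers (N := M k.+1)) => //.
- by move=> m; apply: (@sub_measurable k); exact: hM.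
- apply/measurable_EFinP; exact: measurable_grad_norm.
- exact: (measurable_sub_fun (@sub_measurable k) (@measurable_cond_bound k)).
- by move=> w; rewrite lee_fin enorm_ge0.
- exact: cond_bound_ge0.
move=> [|m].
  rewrite (_ : _ `&` _ = set0) ?integral_set0//.
  apply/seteqP; split=> // w [_ /= Mw].
  by have := RA_size_gt0 RA k w; rewrite Mw.
set D := A `&` _; have hD : history Yt M k D by exact: historyI.
have mD : measurable D by exact: (@sub_measurable k).
apply: (le_trans (integral_grad_norm_fiber_le (ltn0Sn m) hD _)).
  by move=> w [].
rewrite /cond_bound ge0_integralD//; last 4 first.
- by move=> w _; rewrite le_max lexx orbT.
- apply: measurable_funTS.
  exact: (measurable_sub_fun (@sub_measurable k) (@measurable_pos_Eeps k)).
- by move=> w _; rewrite lee_fin error_bound_ge0.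
- apply: measurable_funTS.
  exact: (measurable_sub_fun (@sub_measurable k) (@measurable_error_bound k)).
have eps0 w : (0 <= (eps k.+1 w)%:E)%E.
  by rewrite lee_fin; exact: (RA_tol_ge0 RA).
rewrite (integral_cond_expectation_pos (@sub_measurable k) (condEeps k) eps0)//.
rewrite leeD2l// -integral_cst// le_eqVlt; apply/orP; left; apply/eqP.
by apply: eq_integral => w; rewrite inE => -[_ /= ->].
Qed.

Lemma cond_bound_cvg0 : {ae P, forall w, cond_bound k w @[k --> \oo] --> 0%E}.
Proof.
apply: filterS2 M_cvg Eeps_cvg => w Mw Ew.
rewrite -[0%E in X in _ --> X]adde0; apply: cvgeD => //.
  apply: ge0_near_le_cvge0 => [|e e0].
    by apply: nearW => k; rewrite le_max lexx orbT.
  have := cvge0_near_le Ew e0; apply: filterS => k le_e.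
  by rewrite ge_max le_e lee_fin ltW.
apply: cvg_EFin; first exact: nearW.
have MS : M k.+1 w @[k --> \oo] --> \oo.
  by rewrite (cvg_shiftS (fun k => M k w)).
apply: (@cvg_comp _ _ _ (fun k => M k.+1 w) error_bound); first exact: MS.
exact: error_bound_cvg0.
Qed.

Lemma cond_grad_norm_cvg0 (Egrad : nat -> Omega -> \bar R) :
  (forall k, cond_expectation P (history Yt M k)
     (fun w => (G k w)%:E) (Egrad k)) ->
  {ae P, forall w, Egrad k w @[k --> \oo] --> 0%E}.
Proof.
move=> cE.
have G0 k w : (0 <= (G k w)%:E)%E by rewrite lee_fin enorm_ge0.
have E0 : {ae P, forall w k, (0 <= Egrad k w)%E}.
  apply/ae_foralln => k.
  exact: (cond_expectation_ge0 (@sub_measurable k) (cE k) (G0 k)).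
have EB : {ae P, forall w k, (Egrad k w <= cond_bound k w)%E}.
  apply/ae_foralln => k.
  apply: (cond_expectation_le (@sub_measurable k) (cE k)) => //.
  - exact: measurable_cond_bound.
  - exact: cond_bound_ge0.
  - apply/measurable_EFinP; exact: measurable_grad_norm.
  - have hT : history Yt M k setT by exact: historyT.
    apply: le_lt_trans (integral_grad_norm_crude hT) _.
    by rewrite probability_setT mule1 ltry.
  - exact: integral_grad_norm_le.
apply: filterS3 E0 EB cond_bound_cvg0 => w E0 EB B_cvg.
apply: (squeeze_cvge _ (cvg_cst 0%E) B_cvg).
by apply: nearW => k; rewrite E0 EB.
Qed.

(** The conditional bound may have an infinite mean, as the tolerance may. Where
    the bound exceeds the constant, the inequality g <= 1 + g^2 and the bounded
    conditional second moment replace it. *)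
Lemma integral_grad_norm_le_min k :
  (\int[P]_w (G k w)%:E <=
   \int[P]_w mine (cond_bound k w) (1 + l2 ^+ 2)%:E)%E.
Proof.
set C : R := 1 + l2 ^+ 2.
have C0 : 0 <= C by rewrite addr_ge0 ?sqr_ge0.
pose A := [set w | (cond_bound k w < C%:E)%E].
have mB := measurable_sub_fun (@sub_measurable k) (@measurable_cond_bound k).
have hA : <<s history_events Yt M k>> A.
  have := measurable_lte (measurableT : measurable [set: HistType k])
    (@measurable_cond_bound k) (measurable_cst C%:E).
  by rewrite setTI.
have hAC : <<s history_events Yt M k>> (~` A).
  exact: (@measurableC _ (HistType k)).
have mA := sub_measurable hA; have mAC := sub_measurable hAC.
have mG : measurable_fun setT (fun w => (G k w)%:E).
  apply/measurable_EFinP; exact: measurable_grad_norm.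
have mmin : measurable_fun setT (fun w => mine (cond_bound k w) C%:E).
  exact: measurable_mine.
rewrite -(setUv A) !ge0_integral_setU//; try exact/disj_setPCl;
  try by rewrite setUv.
- apply: leeD.
    rewrite (le_trans (integral_grad_norm_le hA))// le_eqVlt; apply/orP; left.
    apply/eqP; apply: eq_integral => w; rewrite inE => /ltW Aw.
    exact/esym/min_idPl.
  rewrite (le_trans (integral_grad_norm_crude hAC))// -integral_cst//.
  rewrite le_eqVlt; apply/orP; left.
  apply/eqP; apply: eq_integral => w; rewrite inE => /negP.
  rewrite -leNgt => Aw.
  exact/esym/min_idPr.
- by move=> w _; rewrite le_min cond_bound_ge0 lee_fin.
- by move=> w _; rewrite lee_fin enorm_ge0.
Qed.

Lemma mean_grad_norm_cvg0 : (\int[P]_w (G k w)%:E)%E @[k --> \oo] --> 0%E.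
Proof.
set C : R := 1 + l2 ^+ 2.
have C0 : 0 <= C by rewrite addr_ge0 ?sqr_ge0.
have min0 k w : (0 <= mine (cond_bound k w) C%:E)%E.
  by rewrite le_min cond_bound_ge0 lee_fin.
have mmin k : measurable_fun setT (fun w => mine (cond_bound k w) C%:E).
  apply: measurable_mine => //.
  exact: (measurable_sub_fun (@sub_measurable k) (@measurable_cond_bound k)).
have min_cvg : (\int[P]_w mine (cond_bound k w) C%:E)%E @[k --> \oo] --> 0%E.
  have [||_ _] := dominated_convergence (mu := P)
    (f_ := fun k w => mine (cond_bound k w) C%:E)
    (f := cst 0%E) (g := EFin \o cst C) measurableT mmin (measurable_cst _)
    _ (finite_measure_integrable_cst P _ measurableT);
    last by rewrite integral0; apply.
  - apply: filterS cond_bound_cvg0 => w B0 _.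
    apply: ge0_near_le_cvge0 => [|r r0]; first exact: nearW.
    have := cvge0_near_le B0 r0; apply: filterS => k Br.
    by rewrite ge_min Br.
  - apply: filterE => w k _; rewrite gee0_abs//.
    by rewrite ge_min lexx orbT.
apply: (squeeze_cvge _ (cvg_cst 0%E) min_cvg).
apply: nearW => k; rewrite integral_grad_norm_le_min andbT.
by apply: integral_ge0 => w _; rewrite lee_fin enorm_ge0.
Qed.

End retrospective_approximation.

Theorem theorem2 (R : realType) (d : nat)
  (dY : measure_display) (Y : measurableType dY) (PY : probability Y R)
  (dO : measure_display) (Omega : measurableType dO) (P : probability Omega R)
  (F : 'rV[R]_d -> Y -> R) (c0 l2 : R)
  (Yt : nat -> Omega -> Y)
  (solver : ('rV[R]_d -> R) -> 'rV[R]_d -> nat -> 'rV[R]_d)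
  (M : nat -> Omega -> nat) (eps : nat -> Omega -> R)
  (X : nat -> Omega -> 'rV[R]_d)
  (Eeps Esq : nat -> Omega -> \bar R) :
  smooth_stochastic_problem PY F ->
  0 < c0 ->
  iid P PY Yt ->
  RA_iterates F Yt solver M eps X ->
  (* Eeps k = E[eps_(k+1) | F_k] *)
  (forall k, cond_expectation P (history Yt M k)
     (fun w => (eps k.+1 w)%:E) (Eeps k)) ->
  (* Esq k = E[ |grad f(X_(k+1))|^2 | F_k] *)
  (forall k, cond_expectation P (history Yt M k)
     (fun w => (enorm (grad (objective PY F) (X k.+1 w)) ^+ 2)%:E) (Esq k)) ->
  {ae P, forall w, M k w @[k --> \oo] --> \oo} ->
  {ae P, forall w, Eeps k w @[k --> \oo] --> 0%E} ->
  {ae P, forall w,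
    ereal_sup (range (fun x : 'rV[R]_d =>
      (enorm (mean_rel_error PY F c0 m (Yt ^~ w) x))%:E)) @[m --> \oo]
    --> 0%E} ->
  (\int[PY]_y (envelope PY F c0 y ^+ 2) < +oo)%E ->
  {ae P, forall w, (ereal_sup (range (Esq ^~ w)) <= (l2 ^+ 2)%:E)%E} ->
  (forall Egrad : nat -> Omega -> \bar R,
     (forall k, cond_expectation P (history Yt M k)
        (fun w => (enorm (grad (objective PY F) (X k.+1 w)))%:E) (Egrad k)) ->
     {ae P, forall w, Egrad k w @[k --> \oo] --> 0%E}) /\
  ('E_P[fun w => enorm (grad (objective PY F) (X k w))] @[k --> \oo] --> 0)%E.
Proof.
move=> smoothF c0_gt0 iidY RA cEeps cEsq Mc Ec uniform_law env Eb; split.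
  move=> Egrad cE.
  exact: (cond_grad_norm_cvg0 smoothF c0_gt0 iidY RA cEeps cEsq Mc Ec
    uniform_law env Eb cE).
rewrite -cvg_shiftS unlock.
exact: (mean_grad_norm_cvg0 smoothF c0_gt0 iidY RA cEeps cEsq Mc Ec
  uniform_law env Eb).
Qed.
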